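(* After identifying Euclidean space $\mathbb{R}^4$ with the quaternions $\mathbb{H}$, for any real number $C$, the formulas $$A(x)=\mathrm{Im}\Big(\frac{3C}{C^2|x|^4+4C|x|^2+1}\,\bar x\,dx\Big),\qquad \phi(x)=\mathrm{Im}\Big(\frac{3C(C|x|^2+1)}{(C^2|x|^4+4C|x|^2+1)(C|x|^2-1)}\,\bar x\,dx\Big)$$ give solutions to the Kapustin-Witten equations $$F_A-\phi\wedge\phi-\star d_A\phi=0,\qquad d_A^{\star}\phi=0,$$ with the following properties: (1) For $C\neq 0$, the solutions are smooth away from $|x|=\frac{1}{\sqrt{C}}$ and decay to $0$ when $|x|\to\infty$. (2) The solutions have instanton number $0$. (3) When $C\to+\infty$, $|F_A|$ converges to a Dirac measure at $x=0$. (4) For $C\neq 0$, the pole singularity of $\phi$ at $|x|=\frac{1}{\sqrt{C}}$ cannot be removed by $SU(2)$ gauge transformations.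
   Context: Write $x=x_1+x_2I+x_3J+x_4K\in\mathbb{H}$, $dx=dx_1+I\,dx_2+J\,dx_3+K\,dx_4$; $\bar x$ is the quaternionic conjugate and $\mathrm{Im}$ the imaginary part. $SU(2)$ is identified with the unit quaternions and $\mathfrak{su}(2)$ with the imaginary quaternions, so $A$ (a connection form) and $\phi$ are $\mathfrak{su}(2)$-valued 1-forms. $F_A=dA+A\wedge A$ is the curvature, $d_A\phi=d\phi+A\wedge\phi+\phi\wedge A$, $\star$ is the Hodge star of the Euclidean metric, and $d_A^\star\phi=0$ means $d\star\phi+A\wedge\star\phi+\star\phi\wedge A=0$. $|F_A|$ is the pointwise norm of the curvature. The instanton number of a solution $(A,\phi)$ is $k=\frac{1}{4\pi^2}\int_{\mathbb{R}^4}\mathrm{tr}(F_A\wedge F_A)\in\mathbb{R}$, where $\mathrm{tr}$ is the trace form on $\mathfrak{su}(2)$.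
   Formalization: Smoothness in (1) and claim (4) are proved for C>0 and (2) for C≥0 (for C<0, 1/√C is not real and the instanton integral diverges); in (3), |F_A|→∞ at 0 and →0 elsewhere, and |F_A|² dx (not |F_A|, whose limit is zero) tends to a positive multiple of the Dirac measure. *)

(* Defs.v *)
From HB Require Import structures.
From mathcomp Require Import all_boot all_order all_algebra.
From mathcomp Require Import all_classical all_reals all_analysis.
Set Implicit Arguments.
Unset Strict Implicit.
Unset Printing Implicit Defensive.
Import Order.TTheory GRing.Theory Num.Theory numFieldNormedType.Exports.
Local Open Scope classical_set_scope.
Local Open Scope ring_scope.

(* The quaternion x1 + x2 I + x3 J + x4 K is the row vector (x1, x2, x3, x4),
   so that quaternions and points of Euclidean R^4 have the same type.
   The library norm `|x| on row vectors is the max norm; the Euclidean norm is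
   qnorm below.  Both induce the same topology and the same derivatives. *)
Notation quat R := 'rV[R]_4.

Section Quaternions.
Variable R : realType.
Implicit Types x y : quat R.

Definition mkquat (a b c d : R) : quat R :=
  \row_(i < 4) nth 0 [:: a; b; c; d] i.

Definition q1 x : R := x 0 (@Ordinal 4 0 isT).
Definition qI x : R := x 0 (@Ordinal 4 1 isT).
Definition qJ x : R := x 0 (@Ordinal 4 2 isT).
Definition qK x : R := x 0 (@Ordinal 4 3 isT).

Definition qmul x y : quat R :=
  mkquat (q1 x * q1 y - qI x * qI y - qJ x * qJ y - qK x * qK y)
         (q1 x * qI y + qI x * q1 y + qJ x * qK y - qK x * qJ y)
         (q1 x * qJ y - qI x * qK y + qJ x * q1 y + qK x * qI y)
         (q1 x * qK y + qI x * qJ y - qJ x * qI y + qK x * q1 y).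

Definition qconj x : quat R := mkquat (q1 x) (- qI x) (- qJ x) (- qK x).
Definition qIm x : quat R := mkquat 0 (qI x) (qJ x) (qK x).
Definition qnorm x : R := Num.sqrt (\sum_(i < 4) x 0 i ^+ 2).

(* Trace of the 2 x 2 complex matrix representing a quaternion. *)
Definition qtr x : R := 2 * q1 x.

Definition qbasis (i : 'I_4) : quat R := delta_mx 0 i.

(* C^oo on an open set U: all iterated partial derivatives are (Frechet)
   differentiable at every point of U. *)
Definition iter_partial (s : seq 'I_4) (f : quat R -> quat R)
  : quat R -> quat R :=
  foldr (fun i h x => 'D_(qbasis i) h x) f s.

Definition smooth_on (U : set (quat R)) (f : quat R -> quat R) : Prop :=
  forall (s : seq 'I_4) x, U x -> differentiable (iter_partial s f) x.

End Quaternions.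

Section Forms.
Variable R : realType.

(* A quaternion-valued differential form on R^4, of possibly mixed degree: for
   S = {i1 < ... < ip}, w S is the coefficient function of
   dx_i1 /\ ... /\ dx_ip. *)
Definition form : Type := {set 'I_4} -> quat R -> quat R.
Implicit Types (w a b A phi : form) (U : set (quat R)).

(* For disjoint T and V, dx_T /\ dx_V = shuffle_sign T V dx_(T u V). *)
Definition shuffle_sign (T V : {set 'I_4}) : R :=
  (-1) ^+ #|[set p : 'I_4 * 'I_4 | [&& p.1 \in T, p.2 \in V & (p.2 < p.1)%N]]%SET|.

Definition addf a b : form := fun S x => a S x + b S x.

Definition wedge a b : form := fun S x =>
  \sum_(T in powerset S)
    shuffle_sign T (S :\: T) *: qmul (a T x) (b (S :\: T) x).

Definition extd w : form := fun S x =>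
  \sum_(i in S) shuffle_sign [set i]%SET (S :\ i) *: 'D_(qbasis R i) (w (S :\ i)) x.

(* Hodge star of the Euclidean metric with the orientation
   dx1 /\ dx2 /\ dx3 /\ dx4. *)
Definition hodge w : form := fun S x => shuffle_sign (~: S) S *: w (~: S) x.

Definition fnorm w (x : quat R) : R :=
  Num.sqrt (\sum_(S : {set 'I_4}) qnorm (w S x) ^+ 2).

Definition curvature A : form := addf (extd A) (wedge A A).

(* Covariant exterior derivative on forms w of odd degree. *)
Definition covd A w : form := addf (extd w) (addf (wedge A w) (wedge w A)).

Definition smooth_form U w : Prop := forall S, smooth_on U (w S).

(* The imaginary quaternions are su(2). *)
Definition su2_oneform U w : Prop := forall S x, U x ->
  q1 (w S x) = 0 /\ (#|S| != 1%N -> w S x = 0).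

Definition KW_solution U A phi : Prop :=
  [/\ su2_oneform U A /\ su2_oneform U phi,
      smooth_form U A /\ smooth_form U phi,
      forall S x, U x ->
        curvature A S x - wedge phi phi S x - hodge (covd A phi) S x = 0 &
      forall S x, U x -> covd A (hodge phi) S x = 0].

Definition decays w : Prop := forall eps : R, 0 < eps ->
  \forall M \near +oo, forall x : quat R, M <= qnorm x -> fnorm w x < eps.

(* dq = dx1 + I dx2 + J dx3 + K dx4 *)
Definition dq : form := fun S _ => \sum_(i < 4 | S == [set i]%SET) qbasis R i.

Definition Im_xbar_dx (f : quat R -> R) : form := fun S x =>
  qIm (f x *: qmul (qconj x) (dq S x)).

(* Action of a gauge transformation g on su(2)-valued forms,
   w |-> g w g^-1; for unit quaternions g^-1 is the conjugate. *)
Definition gauge_act (g : quat R -> quat R) w : form := fun S x =>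
  qmul (qmul (g x) (w S x)) (qconj (g x)).

Definition gauge_transformation U (g : quat R -> quat R) : Prop :=
  smooth_on U g /\ forall x, U x -> qnorm (g x) = 1.

(* The singularity of w along P can be removed near x0: on a neighbourhood U
   of x0, some gauge transformation defined off P takes w to (the restriction
   of) a form which is continuous at x0.  Only continuity is asked of the
   extension, so that removability in the smooth sense is a special case. *)
Definition gauge_removable_at (P : set (quat R)) w (x0 : quat R) : Prop :=
  exists (U : set (quat R)) (g : quat R -> quat R) (psi : form),
    [/\ open U /\ U x0,
        gauge_transformation (U `\` P) g,
        forall S, {for x0, continuous (psi S)} &
        forall S x, (U `\` P) x -> psi S x = gauge_act g w S x].

End Forms.

Section Integration.
Variable R : realType.

Definition R4 : Type := (R * R * R * R)%type.

Definition point (p : R4) : quat R := mkquat p.1.1.1 p.1.1.2 p.1.2 p.2.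

Definition lebesgue4 :=
  ((((@lebesgue_measure R) \x (@lebesgue_measure R)) \x
    (@lebesgue_measure R)) \x (@lebesgue_measure R))%E.

(* tr (F_A /\ F_A) = chern_density A dx1 /\ dx2 /\ dx3 /\ dx4 *)
Definition chern_density (A : form R) (x : quat R) : R :=
  qtr (wedge (curvature A) (curvature A) [set: 'I_4]%SET x).

(* The requirement of integrability makes the integral meaningful. *)
Definition has_instanton_number (A : form R) (k : R) : Prop :=
  lebesgue4.-integrable setT (fun p => (chern_density A (point p))%:E) /\
  k = (4 * pi ^+ 2)^-1 *
      Rintegral lebesgue4 setT (fun p => chern_density A (point p)).

(* Weak convergence, as C -> +oo, of the measures rho_C dx on R^4 to the
   measure m delta_x0. *)
Definition cvg_to_dirac (rho : R -> quat R -> R) (m : R) (x0 : quat R) : Prop :=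
  forall g : quat R -> R, continuous g ->
    (exists M : R, forall x, `|g x| <= M) ->
    (\int[lebesgue4]_p (g (point p) * rho C (point p))%:E)%E
      @[C --> +oo] --> (m * g x0)%:E.

End Integration.

Section Solutions.
Variable R : realType.
Implicit Types (C : R) (x : quat R).

Definition kw_den C x : R :=
  C ^+ 2 * qnorm x ^+ 4 + 4 * C * qnorm x ^+ 2 + 1.

Definition kwA C : form R := Im_xbar_dx (fun x => 3 * C / kw_den C x).

Definition kwPhi C : form R := Im_xbar_dx (fun x =>
  3 * C * (C * qnorm x ^+ 2 + 1) / (kw_den C x * (C * qnorm x ^+ 2 - 1))).

(* The points where the formulas make sense.  For C > 0 the factor kw_den does
   not vanish; for C < 0 it vanishes on two spheres. *)
Definition kw_domain C : set (quat R) :=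
  [set x | kw_den C x != 0 /\ C * qnorm x ^+ 2 - 1 != 0].

Definition pole_sphere C : set (quat R) :=
  [set x | qnorm x = 1 / Num.sqrt C].

End Solutions.

(* Main.v *)
Require Import Defs.
From HB Require Import structures.
From mathcomp Require Import all_boot all_order all_algebra.
From mathcomp Require Import all_classical all_reals all_analysis.
From mathcomp Require Import measurable_realfun ring lra.
Import Order.TTheory GRing.Theory Num.Theory numFieldNormedType.Exports.
Import Defs.
Local Open Scope classical_set_scope.
Local Open Scope ring_scope.

(** Let t = |x|^2 and Theta = Im (xbar dx). Both forms of the statement are radial
    multiples A = f(t) Theta and phi = h(t) Theta, and everything is computed in
    the two-dimensional module spanned by the two-forms dt /\ Theta ([dr2Theta])
    and dTheta. Three pointwise identities carry the algebra:
    Theta /\ Theta = dt /\ Theta - t dTheta ([wedge_Theta_Theta]), dTheta is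
    anti-self-dual ([hodge_dTheta]), and the Hodge star of dt /\ Theta is
    dt /\ Theta - t dTheta ([hodge_dr2Theta]). They turn the curvature equation
    into two scalar identities between f, h, f' and h' ([KW_curvature_radial]),
    which hold for the given rational functions ([profile_ode1], [profile_ode2]);
    the gauge condition holds for all radial forms ([KW_divergence_radial]).

    Smoothness: off their poles the coefficients are rational functions of the
    coordinates, a class stable under partial derivatives ([regular_smooth]).

    The pole: gauge transformations preserve the pointwise norm, and the norm of
    phi is unbounded near every point of the sphere ([kw_pole]).

    The instanton number: with s = C t, the Chern density of A is the divergence
    of the vector field C^2 flux(s) x ([chern_densityE]). Each partial derivative in
    this divergence is integrable, being O((1 + s)^-4), and is the derivative of a
    function vanishing at both ends of every line parallel to its axis, so by
    Fubini the integral over R^4 is 0 ([integral4_zero], [kw_instanton]).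

    Concentration: |F_A|^2 at x is C^2 energy(C t) ([fnorm_curvatureE]), where
    energy is positive and O((1 + s)^-4). Substituting x = y / sqrt C, the
    integral of g |F_A|^2 becomes that of g(y / sqrt C) energy(|y|^2), which
    tends to g(0) times the total energy by dominated convergence ([kw_dirac]). *)

Set Implicit Arguments.
Unset Strict Implicit.
Unset Printing Implicit Defensive.

(** * Quaternions *)

Section QuatAlg.
Variable R : realType.
Implicit Types (x y : quat R) (a k : R).

Lemma quatP x y : [/\ q1 x = q1 y, qI x = qI y, qJ x = qJ y & qK x = qK y] -> x = y.
Proof.
move=> [h0 h1 h2 h3]; apply/rowP => -[[|[|[|[|//]]]] i4];
  rewrite (bool_irrelevance i4 isT); [exact: h0|exact: h1|exact: h2|exact: h3].
Qed.

Lemma mkquatE a b c d : (q1 (mkquat a b c d) = a) * (qI (mkquat a b c d) = b) *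
  (qJ (mkquat a b c d) = c) * (qK (mkquat a b c d) = d).
Proof. by rewrite /q1 /qI /qJ /qK /mkquat !mxE. Qed.

Lemma qcoordD x y : (q1 (x + y) = q1 x + q1 y) * (qI (x + y) = qI x + qI y) *
  (qJ (x + y) = qJ x + qJ y) * (qK (x + y) = qK x + qK y).
Proof. by rewrite /q1 /qI /qJ /qK !mxE. Qed.

Lemma qcoordN x : (q1 (- x) = - q1 x) * (qI (- x) = - qI x) *
  (qJ (- x) = - qJ x) * (qK (- x) = - qK x).
Proof. by rewrite /q1 /qI /qJ /qK !mxE. Qed.

Lemma qcoordZ k x : (q1 (k *: x) = k * q1 x) * (qI (k *: x) = k * qI x) *
  (qJ (k *: x) = k * qJ x) * (qK (k *: x) = k * qK x).
Proof. by rewrite /q1 /qI /qJ /qK !mxE. Qed.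

Lemma qcoord0 : (q1 (0 : quat R) = 0) * (qI (0 : quat R) = 0) *
  (qJ (0 : quat R) = 0) * (qK (0 : quat R) = 0).
Proof. by rewrite /q1 /qI /qJ /qK !mxE. Qed.

Definition qcoordE := (mkquatE, qcoordD, qcoordN, qcoordZ, qcoord0).

Lemma qmul0l x : qmul 0 x = 0.
Proof. by apply: quatP; rewrite /qmul !qcoordE; split; ring. Qed.

Lemma qmul0r x : qmul x 0 = 0.
Proof. by apply: quatP; rewrite /qmul !qcoordE; split; ring. Qed.

Lemma qmulZl k x y : qmul (k *: x) y = k *: qmul x y.
Proof. by apply: quatP; rewrite /qmul !qcoordE; split; ring. Qed.

Lemma qmulZr k x y : qmul x (k *: y) = k *: qmul x y.
Proof. by apply: quatP; rewrite /qmul !qcoordE; split; ring. Qed.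

Lemma qImZ k x : qIm (k *: x) = k *: qIm x.
Proof. by apply: quatP; rewrite /qIm !qcoordE; split; ring. Qed.

Definition qnorm2 x : R := \sum_(i < 4) x 0 i ^+ 2.

Lemma qnorm2E x : qnorm2 x = q1 x ^+ 2 + qI x ^+ 2 + qJ x ^+ 2 + qK x ^+ 2.
Proof.
by rewrite /qnorm2 !big_ord_recl big_ord0 addr0 !addrA /q1 /qI /qJ /qK;
  do !congr (_ + _); congr (x 0 _ ^+ 2); apply: val_inj.
Qed.

Lemma qnorm2_ge0 x : 0 <= qnorm2 x.
Proof. by apply: sumr_ge0 => i _; exact: sqr_ge0. Qed.

Lemma qnorm_sqr x : qnorm x ^+ 2 = qnorm2 x.
Proof. by rewrite sqr_sqrtr// qnorm2_ge0. Qed.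

Lemma qnorm2M x y : qnorm2 (qmul x y) = qnorm2 x * qnorm2 y.
Proof. by rewrite !qnorm2E /qmul !qcoordE; ring. Qed.

End QuatAlg.

(** * Subsets of the four indices *)

Section BoolSets.

(** Subsets of the four coordinate indices are coded by their indicator bits,
    which turns every sum over subsets into a finite computation. *)
Definition bitset (b0 b1 b2 b3 : bool) : {set 'I_4} :=
  [set i : 'I_4 | nth false [:: b0; b1; b2; b3] i]%SET.

Definition o0 := @Ordinal 4 0 isT.
Definition o1 := @Ordinal 4 1 isT.
Definition o2 := @Ordinal 4 2 isT.
Definition o3 := @Ordinal 4 3 isT.

Lemma ord4_ind (P : 'I_4 -> Prop) : P o0 -> P o1 -> P o2 -> P o3 -> forall i, P i.
Proof.
move=> h0 h1 h2 h3 [[|[|[|[|//]]]] i4];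
  rewrite (bool_irrelevance i4 isT); [exact: h0|exact: h1|exact: h2|exact: h3].
Qed.

Lemma big_ord4 (V : nmodType) (F : 'I_4 -> V) :
  \sum_(i < 4) F i = F o0 + F o1 + F o2 + F o3.
Proof.
rewrite !big_ord_recl big_ord0 addr0 !addrA.
by do !congr (_ + _); congr F; apply: val_inj.
Qed.

Lemma in_bitset b0 b1 b2 b3 : (o0 \in bitset b0 b1 b2 b3 = b0) *
  (o1 \in bitset b0 b1 b2 b3 = b1) * (o2 \in bitset b0 b1 b2 b3 = b2) *
  (o3 \in bitset b0 b1 b2 b3 = b3).
Proof. by rewrite !inE. Qed.

Lemma bitset_bits (S : {set 'I_4}) : S = bitset (o0 \in S) (o1 \in S) (o2 \in S) (o3 \in S).
Proof. by apply/finset.setP => i; elim/ord4_ind: i; rewrite in_bitset. Qed.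

Lemma bitset_eq a0 a1 a2 a3 b0 b1 b2 b3 : (bitset a0 a1 a2 a3 == bitset b0 b1 b2 b3) =
  [&& a0 == b0, a1 == b1, a2 == b2 & a3 == b3].
Proof.
apply/eqP/idP => [h|/and4P[/eqP-> /eqP-> /eqP-> /eqP->]//].
have e i : i \in bitset a0 a1 a2 a3 = (i \in bitset b0 b1 b2 b3) by rewrite h.
by move: (e o0) (e o1) (e o2) (e o3); rewrite !in_bitset => -> -> -> ->; rewrite !eqxx.
Qed.

Lemma bitset_sub a0 a1 a2 a3 b0 b1 b2 b3 : (bitset a0 a1 a2 a3 \subset bitset b0 b1 b2 b3) =
  [&& a0 ==> b0, a1 ==> b1, a2 ==> b2 & a3 ==> b3].
Proof.
apply/fintype.subsetP/idP => [h|h i].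
  move: (h o0) (h o1) (h o2) (h o3); rewrite !in_bitset.
  by do 4!(move/implyP => ->).
by move: i; apply: ord4_ind; rewrite !in_bitset; apply/implyP; move: h; case/and4P.
Qed.

Lemma bitsetD a0 a1 a2 a3 b0 b1 b2 b3 : (bitset a0 a1 a2 a3 :\: bitset b0 b1 b2 b3)%SET =
  bitset (a0 && ~~ b0) (a1 && ~~ b1) (a2 && ~~ b2) (a3 && ~~ b3).
Proof.
by apply/finset.setP => i; elim/ord4_ind: i; rewrite !(in_bitset, finset.in_setD)// andbC.
Qed.

Lemma bitsetC b0 b1 b2 b3 : (~: bitset b0 b1 b2 b3)%SET = bitset (~~ b0) (~~ b1) (~~ b2) (~~ b3).
Proof. by apply/finset.setP => i; elim/ord4_ind: i; rewrite !(in_bitset, finset.in_setC). Qed.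

Lemma set1_bitset : ([set o0]%SET = bitset true false false false) *
  ([set o1]%SET = bitset false true false false) *
  ([set o2]%SET = bitset false false true false) *
  ([set o3]%SET = bitset false false false true).
Proof.
by do !split; apply/finset.setP => i; elim/ord4_ind: i; rewrite !(in_bitset, finset.in_set1).
Qed.

Lemma setT_bitset : [set: 'I_4]%SET = bitset true true true true.
Proof. by apply/finset.setP => i; elim/ord4_ind: i; rewrite !(in_bitset, finset.in_setT). Qed.

Lemma big_bitset (V : nmodType) (P : pred {set 'I_4}) (F : {set 'I_4} -> V) :
  \sum_(S | P S) F S = \sum_b0 \sum_b1 \sum_b2 \sum_b3
     if P (bitset b0 b1 b2 b3) then F (bitset b0 b1 b2 b3) else 0.
Proof.
rewrite big_mkcond /= pair_big /= pair_big /= pair_big /=.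
pose h (p : bool * bool * bool * bool) := bitset p.1.1.1 p.1.1.2 p.1.2 p.2.
rewrite (reindex h)//; exists (fun S : {set 'I_4} => (o0 \in S, o1 \in S, o2 \in S, o3 \in S)).
  by move=> [[[a b] c] d] _; rewrite /h !in_bitset.
by move=> S _; rewrite /h/= -bitset_bits.
Qed.

Lemma big_in_bitset (V : nmodType) b0 b1 b2 b3 (F : 'I_4 -> V) :
  \sum_(i in bitset b0 b1 b2 b3) F i = (if b0 then F o0 else 0) +
    (if b1 then F o1 else 0) + (if b2 then F o2 else 0) + (if b3 then F o3 else 0).
Proof. by rewrite big_mkcond big_ord4 !in_bitset. Qed.

Lemma shuffle_sign_bitset (R : realType) a0 a1 a2 a3 b0 b1 b2 b3 :
  shuffle_sign R (bitset a0 a1 a2 a3) (bitset b0 b1 b2 b3) =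
  (-1) ^+ ((a1 && b0) + (a2 && b0) + (a2 && b1) +
           (a3 && b0) + (a3 && b1) + (a3 && b2)).
Proof.
rewrite /shuffle_sign; congr (_ ^+ _).
rewrite -sum1_card big_mkcond/=.
pose inv (i j : 'I_4) : nat :=
  (i \in bitset a0 a1 a2 a3) && (j \in bitset b0 b1 b2 b3) && (j < i)%N.
rewrite (eq_bigr (fun p => inv p.1 p.2)); last first.
  by move=> p _; rewrite inE /inv andbA; case: ifP.
rewrite -(pair_big xpredT xpredT inv) /= {}/inv.
rewrite big_ord4 !(big_ord4 (V := nat)) !in_bitset /= !(andbT, andbF).
by case: a1; case: a2; case: a3; case: b0; case: b1; case: b2.
Qed.

End BoolSets.

Ltac split_bits S :=
  case: (o0 \in S); case: (o1 \in S); case: (o2 \in S); case: (o3 \in S).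

(** * Directional derivatives *)

Section Derivatives.
Variable R : realType.

Lemma is_derive_linear (V W : normedModType R) (L : {linear V -> W}) x v :
  is_derive x v L (L v).
Proof.
have h : (fun h : R => h^-1 *: ((L \o shift x) (h *: v) - L x)) @ 0^' --> L v.
  apply: cvg_near_cst; near=> h.
  have h0 : h != 0 by near: h; exact: nbhs_dnbhs_neq.
  by rewrite /= (linearD L) (linearZ_LR L) addrK scalerA mulVf// scale1r.
have dL : derivable L x v by apply/cvg_ex; exists (L v).
by apply: (DeriveDef dL); exact: (cvg_lim (@norm_hausdorff _ _) h).
Unshelve. all: by end_near. Qed.

Lemma is_derive_coord n (x v : 'rV[R]_n) i :
  is_derive x v (fun y : 'rV[R]_n => y 0 i : R) (v 0 i).
Proof.
have lin : linear (fun y : 'rV[R]_n => y 0 i : R^o) by move=> k a b; rewrite !mxE.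
pose M := GRing.isLinear.Build _ _ _ _ _ lin.
pose L : {linear 'rV[R]_n -> R^o} := HB.pack (fun y : 'rV[R]_n => y 0 i : R^o) M.
exact: (is_derive_linear L).
Qed.

Lemma is_derive_row n (V : normedModType R) (M : V -> 'rV[R]_n) x v (d : 'rV[R]_n) :
  (forall j, is_derive x v (fun y => M y 0 j) (d 0 j)) -> is_derive x v M d.
Proof.
move=> h; have dM : derivable M x v.
  by apply/derivable_mxP => i j; rewrite ord1; case: (h j).
apply: DeriveDef => //; rewrite derive_mx//; apply/matrixP => i j.
by rewrite ord1 mxE; case: (h j).
Qed.

Lemma is_derive_scale n (V : normedModType R) (f : V -> R) (M : V -> 'rV[R]_n) x v
    df (dM : 'rV[R]_n) :
  is_derive x v f df -> is_derive x v M dM ->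
  is_derive x v (fun y => f y *: M y) (f x *: dM + df *: M x).
Proof.
move=> hf [hM <-]; apply: is_derive_row => j.
have hMj : is_derive x v (fun y => M y 0 j) ('D_v M x 0 j).
  rewrite derive_mx// mxE; apply: derivableP.
  by move/derivable_mxP : hM; exact.
rewrite (_ : (fun y => _) = f * (fun y => M y 0 j)); last first.
  by apply/funext => y; rewrite !mxE.
by apply: is_derive_eq; rewrite !mxE /GRing.scale/= [df * _]mulrC.
Qed.

(** A directional derivative is an ordinary derivative along a line, which
    reduces the chain rule to the one-variable one. *)
Lemma deriveE_line (V W : normedModType R) (f : V -> W) x v :
  'D_v f x = 'D_1 (fun h : R => f (h *: v + x)) 0.
Proof.
rewrite /derive; set g1 := fun h => h^-1 *: _; set g2 := fun h => h^-1 *: _.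
suff -> : g1 = g2 by [].
by apply/funext => h; rewrite /g1 /g2 /= addr0 scale0r add0r [_%:A]mulr1.
Qed.

Lemma is_derive_comp (V : normedModType R) (u : V -> R) (F : R -> R) x v du dF :
  is_derive x v u du -> is_derive (u x) 1 F dF ->
  is_derive x v (fun y => F (u y)) (dF * du).
Proof.
move=> [u1 <-] [F1 <-].
have l1 := (derivable1P u x v).1 u1.
have l2 : derivable F (u (0 *: v + x)) 1 by rewrite scale0r add0r.
apply: DeriveDef.
  apply/derivable1P/derivable1_diffP.
  exact: (differentiable_comp (f := fun h : R => u (h *: v + x)) (g := F)
    ((derivable1_diffP _ _).1 l1) ((derivable1_diffP _ _).1 l2)).
rewrite (deriveE_line (fun y => F (u y)) x v) (deriveE_line u x v) -!derive1E.
have := derive1_comp l1 l2; rewrite scale0r add0r => <-.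
by [].
Qed.

Lemma is_derive_qnorm2 (x v : quat R) :
  is_derive x v (@qnorm2 R) (\sum_i 2 * x 0 i * v 0 i).
Proof.
rewrite (_ : @qnorm2 R = \sum_(i < 4) (fun y : quat R => y 0 i) ^+ 2); last first.
  by apply/funext => y; rewrite /qnorm2 fct_sumE.
apply: is_derive_sum => i.
by have := is_deriveX 2 (is_derive_coord x v i); rewrite /GRing.scale/= expr1.
Qed.

End Derivatives.

(** * Radial forms *)

Section RadialForms.
Variable R : realType.
Implicit Types (x : quat R) (f h : quat R -> R) (S T : {set 'I_4}).

Definition Theta : form R := Im_xbar_dx (fun=> 1).

Lemma Im_xbar_dxE f S x : Im_xbar_dx f S x = f x *: Theta S x.
Proof. by rewrite /Theta /Im_xbar_dx scale1r qImZ. Qed.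

Lemma qbasisE (i : 'I_4) : qbasis R i =
  mkquat (i == o0)%:R (i == o1)%:R (i == o2)%:R (i == o3)%:R.
Proof.
by apply: quatP; rewrite !mkquatE /qbasis /q1 /qI /qJ /qK !mxE !eqxx /=;
  elim/ord4_ind: i.
Qed.

Lemma dq_bitset b0 b1 b2 b3 x : @dq R (bitset b0 b1 b2 b3) x =
  match b0, b1, b2, b3 with
  | true, false, false, false => qbasis R o0
  | false, true, false, false => qbasis R o1
  | false, false, true, false => qbasis R o2
  | false, false, false, true => qbasis R o3
  | _, _, _, _ => 0
  end.
Proof.
rewrite /dq big_mkcond/= big_ord4 !set1_bitset !bitset_eq.
by case: b0; case: b1; case: b2; case: b3; rewrite /= ?(addr0, add0r).
Qed.

Lemma Theta_bitset b0 b1 b2 b3 x : Theta (bitset b0 b1 b2 b3) x =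
  match b0, b1, b2, b3 with
  | true, false, false, false => mkquat 0 (- qI x) (- qJ x) (- qK x)
  | false, true, false, false => mkquat 0 (q1 x) (- qK x) (qJ x)
  | false, false, true, false => mkquat 0 (qK x) (q1 x) (- qI x)
  | false, false, false, true => mkquat 0 (- qJ x) (qI x) (q1 x)
  | _, _, _, _ => 0
  end.
Proof.
rewrite /Theta /Im_xbar_dx scale1r dq_bitset.
by case: b0; case: b1; case: b2; case: b3; rewrite ?qbasisE;
  apply: quatP; rewrite /qIm /qmul /qconj !qcoordE /=; split; ring.
Qed.

Lemma Theta_linear S : linear (Theta S).
Proof.
move=> k x y; rewrite -[LHS]/(Theta S (k *: (x : quat R) + (y : quat R))).
rewrite -[RHS]/(k *: Theta S x + Theta S y) (bitset_bits S) !Theta_bitset.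
by split_bits S; apply: quatP; rewrite !qcoordE; split; ring.
Qed.

Lemma is_derive_Theta S x v : is_derive x v (Theta S) (Theta S v).
Proof.
pose M := GRing.isLinear.Build _ _ _ _ _ (@Theta_linear S).
pose L : {linear quat R -> quat R} := HB.pack (Theta S) M.
exact: (is_derive_linear L).
Qed.

(** d|x|^2 /\ w. *)
Definition dr2_wedge (w : form R) : form R := fun S x =>
  \sum_(i in S) shuffle_sign R [set i]%SET (S :\ i) *: ((2 * x 0 i) *: w (S :\ i) x).

(** The exterior derivative of a form whose coefficients are linear in x. *)
Definition extd_linear (w : form R) : form R := fun S _ =>
  \sum_(i in S) shuffle_sign R [set i]%SET (S :\ i) *: w (S :\ i) (qbasis R i).

Definition dr2Theta := dr2_wedge Theta.
Definition dTheta := extd_linear Theta.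

Definition radial_derivative f x (d : R) :=
  forall i, is_derive x (qbasis R i) f (2 * x 0 i * d).

Lemma radial_comp (F : R -> R) x (d : R) : is_derive (qnorm2 x) 1 F d ->
  radial_derivative (fun y => F (qnorm2 y)) x d.
Proof.
move=> hF i; apply: is_derive_eq.
  exact: (is_derive_comp (is_derive_qnorm2 x (qbasis R i)) hF).
rewrite (bigD1 i)//= big1 => [|j /negPf ji]; last by rewrite mxE eqxx ji mulr0.
by rewrite mxE !eqxx mulr1 addr0 mulrC.
Qed.

(** The Leibniz rule d(f w) = df /\ w + f dw, where df is a multiple of d|x|^2
    because f is radial. *)
Lemma extd_radial f (d : R) (w : form R) S x : radial_derivative f x d ->
  (forall T x v, is_derive x v (w T) (w T v)) ->
  extd (fun T y => f y *: w T y) S x =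
    d *: dr2_wedge w S x + f x *: extd_linear w S x.
Proof.
move=> hf hw; rewrite /extd /dr2_wedge /extd_linear !scaler_sumr -big_split/=.
apply: eq_bigr => i _; set T := (S :\ i)%SET.
have [_ ->] := is_derive_scale (hf i) (hw T x (qbasis R i)).
rewrite scalerDr !scalerA addrC; congr (_ *: _ + _ *: _); ring.
Qed.

Lemma wedge_radial f h S x :
  wedge (Im_xbar_dx f) (Im_xbar_dx h) S x = (f x * h x) *: wedge Theta Theta S x.
Proof.
rewrite /wedge scaler_sumr; apply: eq_bigr => T _.
by rewrite !Im_xbar_dxE qmulZl qmulZr !scalerA; congr (_ *: _); ring.
Qed.

Lemma dTheta_bitset b0 b1 b2 b3 x : dTheta (bitset b0 b1 b2 b3) x =
  match b0, b1, b2, b3 with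
  | true, true, false, false => mkquat 0 2 0 0
  | true, false, true, false => mkquat 0 0 2 0
  | true, false, false, true => mkquat 0 0 0 2
  | false, true, true, false => mkquat 0 0 0 (-2)
  | false, true, false, true => mkquat 0 0 2 0
  | false, false, true, true => mkquat 0 (-2) 0 0
  | _, _, _, _ => 0
  end.
Proof.
rewrite /dTheta /extd_linear big_in_bitset !set1_bitset !bitsetD.
by case: b0; case: b1; case: b2; case: b3 => /=;
  rewrite ?shuffle_sign_bitset ?Theta_bitset ?qbasisE ?scaler0 ?addr0 ?add0r //;
  apply: quatP; rewrite !qcoordE /=; split; ring.
Qed.

Lemma dr2Theta_bitset b0 b1 b2 b3 x : dr2Theta (bitset b0 b1 b2 b3) x =
  let a := 2 * q1 x in let b := 2 * qI x in
  let c := 2 * qJ x in let d := 2 * qK x in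
  let t0 := Theta (bitset true false false false) x in
  let t1 := Theta (bitset false true false false) x in
  let t2 := Theta (bitset false false true false) x in
  let t3 := Theta (bitset false false false true) x in
  match b0, b1, b2, b3 with
  | true, true, false, false => a *: t1 - b *: t0
  | true, false, true, false => a *: t2 - c *: t0
  | true, false, false, true => a *: t3 - d *: t0
  | false, true, true, false => b *: t2 - c *: t1
  | false, true, false, true => b *: t3 - d *: t1
  | false, false, true, true => c *: t3 - d *: t2
  | _, _, _, _ => 0
  end.
Proof.
rewrite /dr2Theta /dr2_wedge big_in_bitset !set1_bitset !bitsetD.
rewrite (_ : x 0 o0 = q1 x)// (_ : x 0 o1 = qI x)// (_ : x 0 o2 = qJ x)// (_ : x 0 o3 = qK x)//.
by case: b0; case: b1; case: b2; case: b3 => /=;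
  rewrite ?shuffle_sign_bitset ?Theta_bitset ?scaler0 ?addr0 ?add0r //;
  apply: quatP; rewrite !qcoordE /=; split; ring.
Qed.

(** Only singletons contribute to the sum over subsets. *)
Lemma wedge_oneform_l (a b : form R) S x :
  (forall T, #|T| != 1%N -> a T x = 0) ->
  wedge a b S x = \sum_(i in S) shuffle_sign R [set i]%SET (S :\ i) *:
    qmul (a [set i]%SET x) (b (S :\ i)%SET x).
Proof.
move=> a0; rewrite /wedge (bigID (mem ((fun i => [set i]%SET) @: S))) /=.
rewrite addrC big1 => [|T /andP[TS TN]]; last first.
  rewrite a0 ?qmul0l ?scaler0//; apply: contra TN => /cards1P[i Ti].
  by rewrite Ti imset_f// -finset.sub1set -Ti -powersetE.
rewrite add0r -(big_imset (fun T => shuffle_sign R T (S :\: T)%SET *: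
  qmul (a T x) (b (S :\: T)%SET x)) (in2W finset.set1_inj)) /=.
apply: eq_bigl => T; rewrite andb_idl// => /imsetP[i iS ->].
by rewrite powersetE finset.sub1set.
Qed.

Lemma wedge_oneform_r (a b : form R) S x :
  (forall T, #|T| != 1%N -> b T x = 0) ->
  wedge a b S x = \sum_(i in S) shuffle_sign R (S :\ i) [set i]%SET *:
    qmul (a (S :\ i)%SET x) (b [set i]%SET x).
Proof.
move=> b0; rewrite /wedge (bigID (mem ((fun i => S :\ i)%SET @: S))) /=.
have SD (i : 'I_4) : i \in S -> (S :\: (S :\ i) = [set i])%SET.
  move=> iS; rewrite finset.setDDr finset.setDv finset.set0U.
  by apply/finset.setIidPr; rewrite finset.sub1set.
rewrite addrC big1 => [|T /andP[TS TN]]; last first.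
  rewrite b0 ?qmul0r ?scaler0//; apply: contra TN => /cards1P[i Ti].
  have iS : i \in S by have := finset.set11 i; rewrite -Ti finset.inE => /andP[].
  apply/imsetP; exists i => //; rewrite -Ti finset.setDDr finset.setDv finset.set0U.
  by apply/esym/finset.setIidPr; rewrite -powersetE.
rewrite add0r (eq_bigl (mem ((fun i => S :\ i)%SET @: S))) => [|T]; last first.
  by rewrite andb_idl// => /imsetP[i iS ->]; rewrite powersetE subsetDl.
rewrite big_imset/=; first by apply: eq_bigr => i iS; rewrite SD.
by move=> i j iS jS /= e; apply: finset.set1_inj; rewrite -[LHS](SD i iS) -[RHS](SD j jS) e.
Qed.

Lemma Theta_deg S x : #|S| != 1%N -> Theta S x = 0.
Proof.
move=> S1; rewrite /Theta /Im_xbar_dx /dq big_pred0 => [|i].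
  by rewrite qmul0r scaler0; apply: quatP; rewrite /qIm !qcoordE; split; rewrite ?oppr0.
by apply/negbTE; apply: contraNneq S1 => ->; rewrite cards1.
Qed.

(** From xbar dx + dxbar x = d|x|^2 one gets
    xbar dx /\ xbar dx = d|x|^2 /\ xbar dx - |x|^2 dxbar /\ dx, and xbar dx differs
    from Theta by d|x|^2 / 2, while dTheta = dxbar /\ dx. *)
Lemma wedge_Theta_Theta S x :
  wedge Theta Theta S x = dr2Theta S x - qnorm2 x *: dTheta S x.
Proof.
rewrite (wedge_oneform_l _ _ (fun T => @Theta_deg T x)) (bitset_bits S) qnorm2E.
rewrite big_in_bitset !set1_bitset !bitsetD dr2Theta_bitset dTheta_bitset.
by split_bits S => /=;
  rewrite ?shuffle_sign_bitset ?Theta_bitset ?(qmul0l, qmul0r, scaler0, addr0, add0r, subr0) //;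
  apply: quatP; rewrite /qmul !qcoordE /=; split; ring.
Qed.

Lemma hodge_bitset (w : form R) b0 b1 b2 b3 x : hodge w (bitset b0 b1 b2 b3) x =
  shuffle_sign R (bitset (~~ b0) (~~ b1) (~~ b2) (~~ b3)) (bitset b0 b1 b2 b3) *:
    w (bitset (~~ b0) (~~ b1) (~~ b2) (~~ b3)) x.
Proof. by rewrite /hodge bitsetC. Qed.

(** dTheta = dxbar /\ dx is anti-self-dual. *)
Lemma hodge_dTheta S x : hodge dTheta S x = - dTheta S x.
Proof.
rewrite (bitset_bits S) hodge_bitset !dTheta_bitset.
by split_bits S => /=; rewrite ?shuffle_sign_bitset ?(scaler0, oppr0) //; apply: quatP;
  rewrite !qcoordE /=; split; ring.
Qed.

(** The form dx /\ dxbar is self-dual, hence so is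
    xbar (dx /\ dxbar) x = |x|^2 dTheta - 2 d|x|^2 /\ Theta. *)
Lemma hodge_dr2Theta S x : hodge dr2Theta S x = dr2Theta S x - qnorm2 x *: dTheta S x.
Proof.
rewrite (bitset_bits S) hodge_bitset !dTheta_bitset !dr2Theta_bitset qnorm2E.
by split_bits S => /=; rewrite ?shuffle_sign_bitset ?Theta_bitset ?(scaler0, subr0) //;
  apply: quatP; rewrite !qcoordE /=; split; ring.
Qed.

End RadialForms.

Section Norms.
Variable R : realType.
Implicit Types (x : quat R) (p q : R).

Lemma wedge_bitset (a b : form R) b0 b1 b2 b3 x : wedge a b (bitset b0 b1 b2 b3) x =
  \sum_c0 \sum_c1 \sum_c2 \sum_c3
    if [&& c0 ==> b0, c1 ==> b1, c2 ==> b2 & c3 ==> b3] then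
      shuffle_sign R (bitset c0 c1 c2 c3)
        (bitset (b0 && ~~ c0) (b1 && ~~ c1) (b2 && ~~ c2) (b3 && ~~ c3)) *:
      qmul (a (bitset c0 c1 c2 c3) x)
        (b (bitset (b0 && ~~ c0) (b1 && ~~ c1) (b2 && ~~ c2) (b3 && ~~ c3)) x)
    else 0.
Proof.
rewrite /wedge big_bitset; do 4!(apply: eq_bigr => ? _).
by rewrite powersetE bitset_sub bitsetD.
Qed.

Lemma q1_qmul (a b : quat R) :
  q1 (qmul a b) = q1 a * q1 b - qI a * qI b - qJ a * qJ b - qK a * qK b.
Proof. by rewrite /qmul mkquatE. Qed.

(** With t = |x|^2, the form w is the sum of the anti-self-dual form
    (q + t p / 2) dTheta and of a self-dual form of the same size as
    (t p / 2) dTheta. Here the squares of the two parts are subtracted; in the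
    norm, next, they are added. *)
Lemma q1_wedge_sq (w : form R) p q x :
  (forall S, w S x = p *: dr2Theta S x + q *: dTheta S x) ->
  q1 (wedge w w [set: 'I_4]%SET x) = 24 * (q * (q + qnorm2 x * p)).
Proof.
move=> hw.
have w0 (b0 b1 b2 b3 : bool) : (b0 + b1 + b2 + b3 != 2)%N -> w (bitset b0 b1 b2 b3) x = 0.
  rewrite hw dr2Theta_bitset dTheta_bitset.
  by case: b0; case: b1; case: b2; case: b3 => // _; rewrite /= !scaler0 addr0.
have w01 := hw (bitset true true false false).
have w02 := hw (bitset true false true false).
have w03 := hw (bitset true false false true).
have w12 := hw (bitset false true true false).
have w13 := hw (bitset false true false true).
have w23 := hw (bitset false false true true).
rewrite !dTheta_bitset !dr2Theta_bitset !Theta_bitset /= in w01 w02 w03 w12 w13 w23.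
(* In degree 4 only the splittings into two pairs of indices contribute. *)
rewrite setT_bitset wedge_bitset !big_bool /=.
rewrite (w0 true true true true)// (w0 false false false false)//.
rewrite (w0 true false false false)// (w0 false true false false)//.
rewrite (w0 false false true false)// (w0 false false false true)//.
rewrite !(qmul0l, qmul0r, scaler0, addr0, add0r) !shuffle_sign_bitset.
rewrite !(qcoordD, qcoordZ) !q1_qmul w01 w02 w03 w12 w13 w23 !qcoordE qnorm2E /=.
ring.
Qed.

Lemma fnorm_sqr (w : form R) p q x :
  (forall S, w S x = p *: dr2Theta S x + q *: dTheta S x) ->
  fnorm w x ^+ 2 = 12 * ((q + qnorm2 x * p) ^+ 2 + q ^+ 2).
Proof.
move=> hw; rewrite /fnorm sqr_sqrtr; last by apply: sumr_ge0 => S _; exact: sqr_ge0.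
rewrite big_bitset !big_bool /= !qnorm_sqr !hw.
rewrite !dTheta_bitset !dr2Theta_bitset /= !(scaler0, addr0, add0r).
rewrite !Theta_bitset !qnorm2E !qcoordE /=.
ring.
Qed.

End Norms.

(** * The equations for radial forms *)

Section Equations.
Variable R : realType.
Implicit Types (x : quat R) (f h : quat R -> R) (p q : R).

Lemma Im_xbar_dx_fun f : Im_xbar_dx f = fun S y => f y *: Theta S y.
Proof. by apply/funext => S; apply/funext => y; rewrite Im_xbar_dxE. Qed.

Lemma curvature_radial f d S x : radial_derivative f x d ->
  curvature (Im_xbar_dx f) S x = (d + f x ^+ 2) *: @dr2Theta R S x +
    (f x - qnorm2 x * f x ^+ 2) *: @dTheta R S x.
Proof.
move=> hf; rewrite /curvature /addf wedge_radial wedge_Theta_Theta Im_xbar_dx_fun.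
rewrite (extd_radial S hf (@is_derive_Theta R)).
by apply: quatP; rewrite !qcoordE; split; ring.
Qed.

Lemma covd_radial f h d S x : radial_derivative h x d ->
  covd (Im_xbar_dx f) (Im_xbar_dx h) S x =
    (d + 2 * f x * h x) *: @dr2Theta R S x +
    (h x - 2 * qnorm2 x * f x * h x) *: @dTheta R S x.
Proof.
move=> hh; rewrite /covd /addf (wedge_radial f h) (wedge_radial h f) wedge_Theta_Theta.
rewrite (Im_xbar_dx_fun h).
rewrite (extd_radial S hh (@is_derive_Theta R)).
by apply: quatP; rewrite !qcoordE; split; ring.
Qed.

(** Comparing the coefficients of dr2Theta and dTheta on both sides of the
    equation gives the two scalar hypotheses. *)
Lemma KW_curvature_radial f h df dh x : radial_derivative f x df ->
  radial_derivative h x dh ->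
  df + f x ^+ 2 - h x ^+ 2 = dh + 2 * f x * h x ->
  f x - qnorm2 x * f x ^+ 2 + qnorm2 x * h x ^+ 2 = - (h x + qnorm2 x * dh) ->
  forall S, curvature (Im_xbar_dx f) S x -
    wedge (Im_xbar_dx h) (Im_xbar_dx h) S x -
    hodge (covd (Im_xbar_dx f) (Im_xbar_dx h)) S x = 0.
Proof.
move=> hf hh e1 e2 S; rewrite (curvature_radial _ hf) (wedge_radial h h) wedge_Theta_Theta.
rewrite [hodge _ S x](_ : _ = (dh + 2 * f x * h x) *: hodge (@dr2Theta R) S x +
    (h x - 2 * qnorm2 x * f x * h x) *: hodge (@dTheta R) S x); last first.
  by rewrite /hodge (covd_radial _ _ hh) scalerDr !scalerA; congr (_ *: _ + _ *: _); ring.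
rewrite hodge_dr2Theta hodge_dTheta.
have -> : df = dh + 2 * f x * h x - f x ^+ 2 + h x ^+ 2 by rewrite -e1; ring.
rewrite [X in (_ *: _ + X *: _)](_ : _ =
  - (h x + qnorm2 x * dh) - qnorm2 x * h x ^+ 2); last by rewrite -e2; ring.
by apply: quatP; rewrite !qcoordE; split; ring.
Qed.

Lemma is_derive_hodge_Theta S x v :
  is_derive x v (hodge (@Theta R) S) (hodge (@Theta R) S v).
Proof. by apply: is_deriveZ; exact: is_derive_Theta. Qed.

Lemma dr2_wedge_hodge_Theta S x : dr2_wedge (hodge (@Theta R)) S x = 0.
Proof.
rewrite (bitset_bits S) /dr2_wedge big_in_bitset !set1_bitset !bitsetD.
rewrite (_ : x 0 o0 = q1 x)// (_ : x 0 o1 = qI x)// (_ : x 0 o2 = qJ x)// (_ : x 0 o3 = qK x)//.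
by split_bits S => /=;
  rewrite ?hodge_bitset ?shuffle_sign_bitset ?Theta_bitset /= ?scaler0 ?addr0 ?add0r //;
  apply: quatP; rewrite !qcoordE /=; split; ring.
Qed.

Lemma extd_hodge_Theta S x : extd_linear (hodge (@Theta R)) S x = 0.
Proof.
rewrite (bitset_bits S) /extd_linear big_in_bitset !set1_bitset !bitsetD.
by split_bits S => /=;
  rewrite ?hodge_bitset ?shuffle_sign_bitset ?Theta_bitset /= ?scaler0 ?addr0 ?add0r //;
  apply: quatP; rewrite !qbasisE !qcoordE /=; split; ring.
Qed.

Lemma wedge_hodge_Theta S x :
  wedge (@Theta R) (hodge (@Theta R)) S x + wedge (hodge (@Theta R)) (@Theta R) S x = 0.
Proof.
rewrite (wedge_oneform_l _ _ (fun T => @Theta_deg R T x)).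
rewrite (wedge_oneform_r _ _ (fun T => @Theta_deg R T x)) (bitset_bits S).
rewrite !big_in_bitset !set1_bitset !bitsetD !hodge_bitset.
split_bits S => /=;
  rewrite ?shuffle_sign_bitset ?Theta_bitset ?(scaler0, qmul0l, qmul0r, addr0, add0r) //.
by apply: quatP; rewrite /qmul !qcoordE /=; split; ring.
Qed.

(** Theta is co-closed, its contraction with x is Im (xbar x) = 0, and each
    coefficient of Theta commutes with itself. *)
Lemma KW_divergence_radial f h d S x : radial_derivative h x d ->
  covd (Im_xbar_dx f) (hodge (Im_xbar_dx h)) S x = 0.
Proof.
move=> hh; rewrite /covd /addf.
have e : hodge (Im_xbar_dx h) = fun T y => h y *: hodge (@Theta R) T y.
  apply/funext => T; apply/funext => y.
  by rewrite /hodge Im_xbar_dxE !scalerA mulrC.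
rewrite {1}e (extd_radial S hh is_derive_hodge_Theta).
rewrite dr2_wedge_hodge_Theta extd_hodge_Theta !scaler0 addr0 add0r.
rewrite (_ : wedge _ _ S x + _ = (f x * h x) *:
  (wedge (@Theta R) (hodge (@Theta R)) S x + wedge (hodge (@Theta R)) (@Theta R) S x)).
  by rewrite wedge_hodge_Theta scaler0.
rewrite e Im_xbar_dx_fun scalerDr /wedge !scaler_sumr.
by congr (_ + _); apply: eq_bigr => T _; rewrite qmulZl qmulZr !scalerA;
  congr (_ *: _); ring.
Qed.

End Equations.

(** * Smoothness *)

Section Smoothness.
Variable R : realType.
Implicit Types (U : set (quat R)) (f g : quat R -> R).

(** The difference of the two functions vanishes near x, so it is differentiable
    there with zero differential. *)
Lemma near_eq_differentiable (V W : normedModType R) (f g : V -> W) (x : V) :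
  (\near x, f x = g x) -> differentiable f x -> differentiable g x.
Proof.
move=> fg df; pose e := g - f.
have e0 : \near x, e x = 0.
  by near do (rewrite /e /= fctE; apply/eqP; rewrite subr_eq0 eq_sym; apply/eqP).
suff de : differentiable e x.
  rewrite (_ : g = f + e); last by apply/funext => y; rewrite /e !fctE/= addrC subrK.
  exact: differentiableD.
have ex : e \o shift x = cst (e x) + (\0 : {linear V -> W}) +o_ 0 id.
  apply/eqaddoP => _/posnumP[eps]; near=> h.
  rewrite !fctE /= (nbhs_singleton e0) (_ : e (h + x) = 0) ?addr0 ?subrr ?normr0 ?mulr_ge0//.
  near: h; have := e0; rewrite (near_shift 0 x)/=.
  by apply: filterS => h /=; rewrite subr0.
have c0 : continuous (\0 : {linear V -> W}) by move=> y; exact: cvg_cst.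
apply/diff_locallyP; rewrite (diff_unique c0 ex); split => //.
Unshelve. all: by end_near. Qed.

(** The rational functions without poles on U, up to equality on U.  Closing
    under equality on U is what makes the class stable under partial
    derivatives, which are only controlled on U. *)
Inductive regular U : (quat R -> R) -> Prop :=
| regular_cst c : regular U (fun=> c)
| regular_coord i : regular U (fun x => x 0 i)
| regular_add f g : regular U f -> regular U g -> regular U (fun x => f x + g x)
| regular_mul f g : regular U f -> regular U g -> regular U (fun x => f x * g x)
| regular_inv f : (forall x, U x -> f x != 0) -> regular U f ->
    regular U (fun x => (f x)^-1)
| regular_ext f g : (forall x, U x -> f x = g x) -> regular U f -> regular U g.

Lemma regular_differentiable U f : open U -> regular U f ->
  forall x, U x -> differentiable f x.
Proof.
move=> oU; elim=> {f} [c|i|f g _ df _ dg|f g _ df _ dg|f f0 _ df|f g fg _ df] x Ux.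
- exact: differentiable_cst.
- exact: differentiable_coord.
- by apply: differentiableD; [exact: df|exact: dg].
- by apply: differentiableM; [exact: df|exact: dg].
- by apply: differentiableV; [exact: df|exact: f0].
- apply: near_eq_differentiable (df x Ux).
  have : nbhs x U by exact: open_nbhs_nbhs.
  exact: filterS.
Qed.

Lemma regular_opp U f : regular U f -> regular U (fun x => - f x).
Proof.
move=> rf; apply: (regular_ext (f := fun x => -1 * f x)) => [x _|].
  by rewrite mulN1r.
by apply: regular_mul => //; exact: regular_cst.
Qed.

Lemma regular_exp U f n : regular U f -> regular U (fun x => f x ^+ n).
Proof.
move=> rf; elim: n => [|n ih].
  by apply: (regular_ext (f := fun=> 1)) (regular_cst _ _) => x _; rewrite expr0.
by apply: (regular_ext (f := fun x => f x * f x ^+ n)) (regular_mul rf ih) => x _;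
  rewrite exprS.
Qed.

Lemma regular_derive U f v : open U -> regular U f -> regular U ('D_v f).
Proof.
move=> oU; elim=> {f} [c|i|f g rf df rg dg|f g rf df rg dg|f f0 rf df|f g fg rf df].
- apply: (regular_ext (f := fun=> 0)) (regular_cst _ _) => x _.
  by rewrite derive_cst.
- apply: (regular_ext (f := fun=> v 0 i)) (regular_cst _ _) => x _.
  by case: (is_derive_coord x v i).
- apply: (regular_ext (f := fun x => 'D_v f x + 'D_v g x)) (regular_add df dg) => x Ux.
  rewrite -deriveD//; apply: diff_derivable; exact: regular_differentiable Ux.
- apply: (regular_ext (f := fun x => f x * 'D_v g x + g x * 'D_v f x)).
    move=> x Ux; rewrite -[LHS]deriveM//; apply: diff_derivable; exact: regular_differentiable Ux.
  by apply: regular_add; apply: regular_mul.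
- apply: (regular_ext (f := fun x => - ((f x)^-1 * (f x)^-1 * 'D_v f x))).
    move=> x Ux; rewrite deriveV ?f0//; last first.
      by apply: diff_derivable; exact: regular_differentiable Ux.
    by rewrite -expr2 -exprVn /GRing.scale/= mulNr.
  have rV := regular_inv f0 rf.
  by apply: regular_opp; apply: regular_mul => //; exact: regular_mul.
- apply: (regular_ext (f := 'D_v f)) df => x Ux; apply: near_eq_derive.
  have : nbhs x U by exact: open_nbhs_nbhs.
  exact: filterS.
Qed.

Lemma row_differentiable (F : quat R -> quat R) x :
  (forall i, differentiable (fun y => F y 0 i) x) -> differentiable F x.
Proof.
move=> dF; rewrite (_ : F = \sum_(i < 4) (fun y => F y 0 i *: qbasis R i)); last first.
  apply/funext => y; rewrite fct_sumE; exact: row_sum_delta.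
apply: differentiable_sum => i; exact: differentiableZl.
Qed.

Lemma regular_smooth U (F : quat R -> quat R) : open U ->
  (forall i, regular U (fun x => F x 0 i)) -> smooth_on U F.
Proof.
move=> oU rF s x Ux; apply: row_differentiable => i.
apply: regular_differentiable Ux => //; elim: s i {x} => [|k s ih] i //=.
apply: (regular_ext (f := 'D_(qbasis R k) (fun y => iter_partial s F y 0 i))).
  move=> x Ux; rewrite derive_mx ?mxE//; apply/derivable_mxP => a b; rewrite ord1.
  by apply: diff_derivable; apply: regular_differentiable Ux.
exact: regular_derive.
Qed.

Lemma regular_qnorm2 U : regular U (@qnorm2 R).
Proof.
apply: (regular_ext (f := fun x : quat R => x 0 o0 ^+ 2 + x 0 o1 ^+ 2 + x 0 o2 ^+ 2 + x 0 o3 ^+ 2)).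
  by move=> x _; rewrite /qnorm2 big_ord4.
by do !apply: regular_add; apply: regular_exp; exact: regular_coord.
Qed.

Lemma regular_Theta U S i : regular U (fun x => @Theta R S x 0 i).
Proof.
apply: (regular_ext (f := fun x : quat R => x 0 o0 * @Theta R S (qbasis R o0) 0 i +
   x 0 o1 * @Theta R S (qbasis R o1) 0 i + x 0 o2 * @Theta R S (qbasis R o2) 0 i +
   x 0 o3 * @Theta R S (qbasis R o3) 0 i)) => [x _|].
  pose M := GRing.isLinear.Build _ _ _ _ _ (@Theta_linear R S).
  pose L : {linear quat R -> quat R} := HB.pack (Theta S) M.
  rewrite [in RHS](_ : Theta S x = \sum_i x 0 i *: L (qbasis R i)).
    by rewrite big_ord4 !mxE.
  rewrite -[LHS]/(L x) {1}(row_sum_delta x) (linear_sum L).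
  by apply: eq_bigr => j _; rewrite (linearZ_LR L).
by do !apply: regular_add; apply: regular_mul; (exact: regular_coord || exact: regular_cst).
Qed.

Lemma Im_xbar_dx_smooth U f : open U -> regular U f -> smooth_form U (Im_xbar_dx f).
Proof.
move=> oU rf S; apply: regular_smooth => // i.
apply: (regular_ext (f := fun x => f x * @Theta R S x 0 i)) => [x _|].
  by rewrite Im_xbar_dxE [RHS]mxE.
by apply: regular_mul => //; exact: regular_Theta.
Qed.

Lemma regular_continuous f : regular setT f -> continuous f.
Proof.
move=> rf x; apply: differentiable_continuous.
exact: regular_differentiable openT rf x I.
Qed.

End Smoothness.

(** * The radial profiles of the solutions *)

Section Profiles.
Variable R : realType.
Implicit Types (C u : R) (x : quat R).

Definition den C u : R := C ^+ 2 * u ^+ 2 + 4 * C * u + 1.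
Definition profA C u : R := 3 * C / den C u.
Definition profPhi C u : R := 3 * C * (C * u + 1) / (den C u * (C * u - 1)).

Definition dprofA C u : R := - (3 * C * (2 * C ^+ 2 * u + 4 * C)) / den C u ^+ 2.
Definition dprofPhi C u : R :=
  (3 * C ^+ 2 * (den C u * (C * u - 1)) - 3 * C * (C * u + 1) *
     ((2 * C ^+ 2 * u + 4 * C) * (C * u - 1) + den C u * C)) /
  (den C u * (C * u - 1)) ^+ 2.

Lemma kw_denE C x : kw_den C x = den C (qnorm2 x).
Proof. by rewrite /kw_den (_ : 4 = 2 * 2)%N// exprM !qnorm_sqr. Qed.

Lemma kwAE C : kwA C = Im_xbar_dx (fun x : quat R => profA C (qnorm2 x)).
Proof. by rewrite /kwA; under eq_fun do rewrite kw_denE. Qed.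

Lemma kwPhiE C : kwPhi C = Im_xbar_dx (fun x : quat R => profPhi C (qnorm2 x)).
Proof. by rewrite /kwPhi; under eq_fun do rewrite kw_denE !qnorm_sqr. Qed.

Lemma is_derive_den C u : is_derive u 1 (den C) (2 * C ^+ 2 * u + 4 * C).
Proof.
rewrite (_ : den C = (cst (C ^+ 2) * id ^+ 2 + cst (4 * C) * id + cst 1))//.
by apply: is_derive_eq; rewrite /GRing.scale /=; ring.
Qed.

Lemma is_derive_inv (f : R -> R) (u df : R) : f u != 0 -> is_derive u 1 f df ->
  is_derive u 1 (fun v => (f v)^-1) (- df / f u ^+ 2).
Proof.
move=> f0 [d1 d2]; apply: DeriveDef; first exact: derivableV.
by rewrite deriveV// d2 /GRing.scale/= mulNr mulrC mulNr.
Qed.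

Lemma is_derive_profA C u : den C u != 0 -> is_derive u 1 (profA C) (dprofA C u).
Proof.
move=> d0.
have := is_deriveM (is_derive_cst (3 * C : R) u (1:R))
  (is_derive_inv d0 (is_derive_den C u)).
move/is_derive_eq; apply.
by rewrite /dprofA /GRing.scale /= mulr0 addr0 mulNr mulrN mulrA mulNr.
Qed.

Lemma is_derive_profPhi C u : den C u != 0 -> C * u - 1 != 0 ->
  is_derive u 1 (profPhi C) (dprofPhi C u).
Proof.
move=> d0 d1.
have h1 : is_derive u 1 (fun v : R => C * v - 1) C.
  rewrite (_ : (fun v : R => _) = cst C * id + cst (- 1))//.
  by apply: is_derive_eq; rewrite /GRing.scale /=; ring.
have h2 : is_derive u 1 (fun v : R => 3 * C * (C * v + 1)) (3 * C ^+ 2).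
  rewrite (_ : (fun v : R => _) = cst (3 * C) * (cst C * id + cst 1))//.
  by apply: is_derive_eq; rewrite /GRing.scale /=; ring.
have h3 := is_deriveM (is_derive_den C u) h1.
have d2 : (den C * (fun v : R => C * v - 1)) u != 0 by rewrite mulf_neq0.
have := is_deriveM h2 (is_derive_inv d2 h3).
move/is_derive_eq; apply; rewrite /dprofPhi /GRing.scale /= !fctE.
by field; rewrite d0 d1.
Qed.

Lemma kw_domainE C x : kw_domain C x <->
  den C (qnorm2 x) != 0 /\ C * qnorm2 x - 1 != 0.
Proof. by rewrite /kw_domain /= kw_denE qnorm_sqr. Qed.

(** Together with the next identity, this is the curvature equation for the two
    profiles, coefficient by coefficient. *)
Lemma profile_ode1 C u : den C u != 0 -> C * u - 1 != 0 ->
  dprofA C u + profA C u ^+ 2 - profPhi C u ^+ 2 =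
  dprofPhi C u + 2 * profA C u * profPhi C u.
Proof.
move=> d0 d1; rewrite /dprofA /profA /profPhi /dprofPhi.
move: d0; rewrite /den => d0; by field; rewrite d1 exprMn.
Qed.

Lemma profile_ode2 C u : den C u != 0 -> C * u - 1 != 0 ->
  profA C u - u * profA C u ^+ 2 + u * profPhi C u ^+ 2 =
  - (profPhi C u + u * dprofPhi C u).
Proof.
move=> d0 d1; rewrite /profA /profPhi /dprofPhi.
move: d0; rewrite /den => d0; by field; rewrite d1 exprMn.
Qed.

End Profiles.

Section KWForms.
Variable R : realType.
Implicit Types (C u : R) (x : quat R).

Lemma su2_Im_xbar_dx U (f : quat R -> R) : su2_oneform U (Im_xbar_dx f).
Proof.
move=> S x _; split; first by rewrite /Im_xbar_dx /qIm mkquatE.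
by move=> S1; rewrite Im_xbar_dxE Theta_deg// scaler0.
Qed.

Lemma regular_den U C : regular U (fun x : quat R => den C (qnorm2 x)).
Proof.
have r2 := @regular_qnorm2 R U; rewrite /den.
apply: regular_add; last exact: regular_cst.
apply: regular_add; apply: regular_mul => //; try exact: regular_cst.
exact: regular_exp.
Qed.

Lemma regular_aff U (a b : R) : regular U (fun x : quat R => a * qnorm2 x + b).
Proof.
apply: regular_add; last exact: regular_cst.
by apply: regular_mul; [exact: regular_cst|exact: regular_qnorm2].
Qed.

Lemma regular_profA U C : (forall x, U x -> den C (qnorm2 x) != 0) ->
  regular U (fun x => profA C (qnorm2 x)).
Proof.
move=> d0; apply: regular_mul; first exact: regular_cst.
by apply: regular_inv => //; exact: regular_den.
Qed.

Lemma regular_profPhi U C : (forall x, U x -> den C (qnorm2 x) != 0) ->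
  (forall x, U x -> C * qnorm2 x - 1 != 0) ->
  regular U (fun x => profPhi C (qnorm2 x)).
Proof.
move=> d0 d1; apply: regular_mul.
  by apply: regular_mul; [exact: regular_cst|exact: regular_aff].
apply: regular_inv => [x Ux|]; first by rewrite mulf_neq0 ?d0 ?d1.
by apply: regular_mul; [exact: regular_den|exact: regular_aff].
Qed.

Lemma open_neq0 (f : quat R -> R) : continuous f -> open [set x | f x != 0].
Proof.
by move=> cf; apply: (@open_comp _ _ f [set y | y != 0]) => // x _; exact: cf.
Qed.

Lemma open_kw_domain C : open (kw_domain C).
Proof.
rewrite (_ : kw_domain C = [set x | den C (qnorm2 x) * (C * qnorm2 x - 1) != 0]).
  apply: open_neq0; apply: regular_continuous.
  by apply: regular_mul; [exact: regular_den|exact: regular_aff].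
apply/seteqP; split=> x /=; first by move/kw_domainE => [d0 d1]; rewrite mulf_neq0.
by rewrite mulf_eq0 negb_or => /andP[d0 d1]; apply/kw_domainE.
Qed.

Lemma kw_solution C : KW_solution (kw_domain C) (kwA C) (kwPhi C).
Proof.
have oU := @open_kw_domain C.
have d0 x : kw_domain C x -> den C (qnorm2 x) != 0 by case/kw_domainE.
have d1 x : kw_domain C x -> C * qnorm2 x - 1 != 0 by case/kw_domainE.
rewrite kwAE kwPhiE; split.
- by split; exact: su2_Im_xbar_dx.
- by split; apply: Im_xbar_dx_smooth => //; [exact: regular_profA|exact: regular_profPhi].
- move=> S x Ux.
  apply: (KW_curvature_radial (df := dprofA C (qnorm2 x)) (dh := dprofPhi C (qnorm2 x))).
  + by apply: radial_comp; apply: is_derive_profA; exact: d0.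
  + by apply: radial_comp; apply: is_derive_profPhi; [exact: d0|exact: d1].
  + by apply: profile_ode1; [exact: d0|exact: d1].
  + by apply: profile_ode2; [exact: d0|exact: d1].
- move=> S x Ux; apply: (@KW_divergence_radial _ _ _ (dprofPhi C (qnorm2 x))).
  by apply: radial_comp; apply: is_derive_profPhi; [exact: d0|exact: d1].
Qed.

Lemma den_ge1 C u : 0 <= C -> 0 <= u -> 1 <= den C u.
Proof. by move=> C0 u0; rewrite /den lerDr addr_ge0// !mulr_ge0// ?exprn_ge0. Qed.

Lemma pole_sphereE C x : 0 < C -> pole_sphere C x <-> C * qnorm2 x = 1.
Proof.
move=> C0; have s0 : 0 < Num.sqrt C by rewrite sqrtr_gt0.
have e : C = Num.sqrt C ^+ 2 by rewrite sqr_sqrtr// ltW.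
rewrite /pole_sphere /= -qnorm_sqr; split => [->|h].
  rewrite {1}e div1r exprVn mulfV// expf_neq0// gt_eqF//.
apply/eqP; rewrite eq_sym -(@eqrXn2 _ 2)//.
- by rewrite div1r exprVn -e -[qnorm x ^+ 2](mulKf (lt0r_neq0 C0)) h mulr1.
- exact: sqrtr_ge0.
Qed.

Lemma open_pole_compl C : 0 < C -> open (~` pole_sphere C : set (quat R)).
Proof.
move=> C0; rewrite (_ : ~` _ = [set x | C * qnorm2 x - 1 != 0]).
  by apply: open_neq0; apply: regular_continuous; exact: regular_aff.
apply/seteqP; split=> x /=.
  by move=> h; apply/eqP => /subr0_eq e; apply: h; exact/pole_sphereE.
by move=> h /(pole_sphereE _ C0) e; move: h; rewrite e subrr eqxx.
Qed.

Lemma kw_smooth C : 0 < C ->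
  smooth_form (~` pole_sphere C) (kwA C) /\ smooth_form (~` pole_sphere C) (kwPhi C).
Proof.
move=> C0; have oU := open_pole_compl C0.
have d0 x : den C (qnorm2 x) != 0.
  by rewrite gt_eqF// (lt_le_trans ltr01)// den_ge1 ?qnorm2_ge0 ?ltW.
rewrite kwAE kwPhiE; split; apply: Im_xbar_dx_smooth => //; first exact: regular_profA.
apply: regular_profPhi => // x Ux; apply/eqP => /subr0_eq e.
by apply: Ux; exact/pole_sphereE.
Qed.

Lemma fnorm_Im_xbar_dx (f : quat R -> R) x :
  fnorm (Im_xbar_dx f) x ^+ 2 = 3 * qnorm2 x * f x ^+ 2.
Proof.
rewrite /fnorm sqr_sqrtr; last by apply: sumr_ge0 => S _; exact: sqr_ge0.
rewrite big_bitset !big_bool /= !qnorm_sqr !Im_xbar_dxE !Theta_bitset !scaler0 !qnorm2E !qcoordE /=.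
ring.
Qed.

End KWForms.

(** * Decay at infinity *)

Section Decay.
Variable R : realType.
Implicit Types (C u : R) (x : quat R).

(** The squared norm of the form is 3 u F(u)^2 with u = |x|^2, at most 3 K^2 / u. *)
Lemma decays_radial (F : R -> R) (K T : R) :
  (forall u, T <= u -> `|F u| * u <= K) ->
  decays (Im_xbar_dx (fun x : quat R => F (qnorm2 x))).
Proof.
move=> FK eps e0; near=> M => x Mx.
have M1 : 1 <= M by near: M; apply: nbhs_pinfty_ge; exact: num_real.
have MT : T <= M by near: M; apply: nbhs_pinfty_ge; exact: num_real.
have Me : 3 * K ^+ 2 / eps ^+ 2 < M by near: M; apply: nbhs_pinfty_gt; exact: num_real.
have Mu : M <= qnorm2 x.
  rewrite -qnorm_sqr (le_trans Mx)// expr2 ler_peMl ?sqrtr_ge0//.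
  exact: le_trans M1 Mx.
have u0 : 0 < qnorm2 x by rewrite (lt_le_trans ltr01)// (le_trans M1).
rewrite -(@ltr_pXn2r _ 2)// ?nnegrE ?sqrtr_ge0 ?ltW// fnorm_Im_xbar_dx.
have h := FK _ (le_trans MT Mu).
have h2 : F (qnorm2 x) ^+ 2 * qnorm2 x ^+ 2 <= K ^+ 2.
  rewrite -exprMn -(real_normK (num_real (_ * _))) normrM (gtr0_norm u0).
  by rewrite ler_pXn2r// nnegrE ?mulr_ge0// ?(le_trans _ h)// ?mulr_ge0// ltW.
rewrite -(ltr_pM2r u0).
have -> : 3 * qnorm2 x * F (qnorm2 x) ^+ 2 * qnorm2 x =
  3 * (F (qnorm2 x) ^+ 2 * qnorm2 x ^+ 2) by ring.
apply: (@le_lt_trans _ _ (3 * K ^+ 2)); first by rewrite ler_pM2l.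
by rewrite [ltRHS]mulrC -ltr_pdivrMr ?exprn_gt0// (lt_le_trans Me).
Unshelve. all: by end_near. Qed.

(** Whatever the sign of C, for s = |C| u >= 10 the quadratic term dominates:
    s^2 - 4 s + 1 >= s. *)
Lemma den_lower C u : 10 <= `|C| * u -> `|C| * u <= `|den C u|.
Proof.
move=> h; have u0 : 0 < u by rewrite ltNge; apply/negP => u0;
  have := mulr_ge0_le0 (normr_ge0 C) u0; lra.
set s := `|C| * u in h *.
have -> : den C u = s ^+ 2 + 4 * (C * u) + 1.
  by rewrite /den /s exprMn real_normK ?num_real//; ring.
have hs : - s <= C * u.
  by have := ler_norm (- (C * u)); rewrite normrN normrM (gtr0_norm u0) -/s; lra.
apply: (@le_trans _ _ (s ^+ 2 + 4 * (C * u) + 1)); last exact: ler_norm.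
nra.
Qed.

Lemma kwA_decays C : C != 0 -> decays (kwA C).
Proof.
move=> C0; rewrite kwAE; have aC : 0 < `|C| by rewrite normr_gt0.
apply: (@decays_radial _ 3 (10 / `|C|)) => u; rewrite ler_pdivrMr// => hu.
rewrite mulrC in hu; have h := den_lower hu.
have d0 : 0 < `|den C u| by lra.
by rewrite /profA normrM normfV normrM (@gtr0_norm _ 3)// mulrAC ler_pdivrMr// -mulrA ler_pM2l.
Qed.

Lemma kwPhi_decays C : C != 0 -> decays (kwPhi C).
Proof.
move=> C0; rewrite kwPhiE; have aC : 0 < `|C| by rewrite normr_gt0.
apply: (@decays_radial _ 6 (10 / `|C|)) => u; rewrite ler_pdivrMr// => hu.
rewrite mulrC in hu; have h := den_lower hu.
have d0 : 0 < `|den C u| by lra.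
have u0 : 0 <= u by rewrite leNgt; apply/negP => u0;
  have := mulr_ge0_le0 (normr_ge0 C) (ltW u0); lra.
have e : `|C * u| = `|C| * u by rewrite normrM (ger0_norm u0).
have h1 : `|C * u + 1| <= `|C| * u + 1 by rewrite -e -{2}(@normr1 R) ler_normD.
have h2 : `|C| * u - 1 <= `|C * u - 1| by rewrite -e -{1}(@normr1 R) lerB_dist.
have d1 : 0 < `|C * u - 1| by lra.
rewrite /profPhi normrM normfV !normrM (@gtr0_norm _ 3)// mulrAC ler_pdivrMr ?mulr_gt0//.
have -> : 3 * `|C| * `|C * u + 1| * u = 3 * (`|C| * u * `|C * u + 1|) by ring.
have -> : 6 * (`|den C u| * `|C * u - 1|) = 3 * (`|den C u| * (2 * `|C * u - 1|)) by ring.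
rewrite ler_pM2l// ler_pM ?mulr_ge0//; lra.
Qed.

End Decay.

(** * The pole *)

Section Pole.
Variable R : realType.
Implicit Types (C u : R) (x : quat R).

Lemma qnorm2_conj x : qnorm2 (qconj x) = qnorm2 x.
Proof. by rewrite !qnorm2E /qconj !qcoordE; ring. Qed.

Lemma fnorm_gauge (g : quat R -> quat R) (w : form R) x : qnorm (g x) = 1 ->
  fnorm (gauge_act g w) x = fnorm w x.
Proof.
move=> g1; rewrite /fnorm; congr Num.sqrt; apply: eq_bigr => S _.
by rewrite !qnorm_sqr /gauge_act !qnorm2M qnorm2_conj -qnorm_sqr g1 expr1n mulr1 mul1r.
Qed.

Lemma fnorm_sqrE (w : form R) x : fnorm w x ^+ 2 = \sum_S qnorm2 (w S x).
Proof.
rewrite /fnorm sqr_sqrtr; last by apply: sumr_ge0 => S _; exact: sqr_ge0.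
by apply: eq_bigr => S _; rewrite qnorm_sqr.
Qed.

Lemma continuous_qnorm2 : continuous (@qnorm2 R).
Proof. by apply: regular_continuous; exact: regular_qnorm2. Qed.

Lemma continuous_fnorm_sqr (w : form R) x0 : (forall S, {for x0, continuous (w S)}) ->
  {for x0, continuous (fun x => fnorm w x ^+ 2)}.
Proof.
move=> cw.
rewrite (_ : (fun x => _) = fun x => \sum_S qnorm2 (w S x)); last first.
  by apply/funext => x; rewrite fnorm_sqrE.
apply: (cvg_big (F := nbhs x0) (op := +%R) (@add_continuous _)) => S _.
by apply: (continuous_comp (cw S)); exact: continuous_qnorm2.
Qed.

(** Gauge transformations preserve the pointwise norm, and that of the form blows
    up along the sphere, whereas a continuous extension would be bounded. *)
Lemma kw_pole C x0 : 0 < C -> pole_sphere C x0 ->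
  ~ gauge_removable_at (pole_sphere C) (kwPhi C) x0.
Proof.
move=> C0 /(pole_sphereE _ C0) x0P [U [g [psi [[oU Ux0] [_ g1] cpsi psiE]]]].
(* G compares the norm of psi with that of kwPhi after clearing denominators:
   it is continuous at x0 and vanishes off the sphere, but D x0 = 0 leaves
   only - N x0 <> 0 in G x0. *)
pose D x := den C (qnorm2 x) * (C * qnorm2 x - 1).
pose N x := 27 * (C ^+ 2 * qnorm2 x * (C * qnorm2 x + 1) ^+ 2).
pose G x := fnorm psi x ^+ 2 * D x ^+ 2 - N x.
have cD : continuous (fun x => D x ^+ 2).
  apply: regular_continuous; apply: regular_exp.
  by apply: regular_mul; [exact: regular_den|exact: regular_aff].
have cN : continuous N.
  apply: regular_continuous; apply: regular_mul; first exact: regular_cst.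
  apply: regular_mul; last by apply: regular_exp; exact: regular_aff.
  by apply: regular_mul; [exact: regular_cst|exact: regular_qnorm2].
have cG : {for x0, continuous G}.
  apply: (cvgB _ (cN x0)).
  by apply: (cvgM _ (cD x0)); exact: continuous_fnorm_sqr.
have G0 : G x0 != 0.
  rewrite /G /D x0P subrr mulr0 expr0n mulr0 sub0r oppr_eq0.
  rewrite (_ : N x0 = 27 * (C * (C * qnorm2 x0) * (C * qnorm2 x0 + 1) ^+ 2)).
    by rewrite x0P gt_eqF// !mulr_gt0.
  by rewrite /N; ring.
have GU x : U x -> C * qnorm2 x != 1 -> G x = 0.
  move=> Ux xP; have nP : (U `\` pole_sphere C) x.
    by split => //; move/(pole_sphereE _ C0) => e; rewrite e eqxx in xP.
  rewrite /G (_ : fnorm psi x = fnorm (kwPhi C) x); last first.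
    rewrite -(fnorm_gauge (kwPhi C) (g1 x nP)) /fnorm; congr Num.sqrt.
    by apply: eq_bigr => S _; rewrite psiE.
  rewrite kwPhiE fnorm_Im_xbar_dx /profPhi -/(D x).
  have D0 : D x != 0.
    rewrite /D mulf_neq0// ?subr_eq0//.
    by rewrite gt_eqF// (lt_le_trans ltr01)// den_ge1 ?qnorm2_ge0 ?ltW.
  by rewrite /N; field.
(* The points s x0 with s <> 1 approach x0 off the sphere. *)
have scale_cvg : (fun s : R => s *: x0) @ (1 : R)^' --> x0.
  apply: cvg_within_filter.
  by have := @scalel_continuous _ _ x0 1; rewrite /continuous_at scale1r.
have near_U : \forall s \near (1 : R)^', U (s *: x0).
  by apply: scale_cvg; exact: open_nbhs_nbhs.
have near_G : \forall s \near (1 : R)^', G (s *: x0) != 0.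
  have h := cvg_comp _ _ scale_cvg cG.
  by apply: (h [set y | y != 0]); apply: open_nbhs_nbhs; split.
have near_1 : \forall s \near (1 : R)^', s != 1 by exact: nbhs_dnbhs_neq.
have near_0 : \forall s \near (1 : R)^', 0 < s.
  by apply: nbhs_dnbhs; exact: lt_nbhsr.
have [s [[Us Gs] s1 s0]] : exists s : R, [/\ U (s *: x0) /\ G (s *: x0) != 0, s != 1 & 0 < s].
  by apply: (@filter_ex _ (1 : R)^'); near=> s; split; [split|..]; near: s.
move: Gs; rewrite GU ?eqxx//.
have -> : qnorm2 (s *: x0) = s ^+ 2 * qnorm2 x0 by rewrite !qnorm2E !qcoordE; ring.
rewrite mulrCA x0P mulr1 -(expr1n _ 2) eqrXn2 ?ltW//.
Unshelve. all: by end_near. Qed.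

End Pole.

(** * Measurability of continuous functions on R^4 *)

Section Measurability.
Variable R : realType.

Lemma measurable_floor_level (n : nat) (k : int) :
  measurable [set y : measurableTypeR R | Num.floor (n.+1%:R * (y : R)) = k].
Proof.
rewrite (_ : [set _ | _] = `[(k%:~R / n.+1%:R : R), (k + 1)%:~R / n.+1%:R[%classic).
  exact: measurable_itv.
apply/seteqP; split=> y /=; rewrite in_itv/= ler_pdivrMr// ltr_pdivlMr// mulrC.
  by move/eqP; rewrite floor_eq mulrC.
by rewrite -floor_eq => /eqP.
Qed.

(** A function of two variables that is measurable in the first and continuous
    in the second is the pointwise limit of the functions obtained by rounding
    the second variable down to a multiple of 1 / (n + 1). *)
Lemma measurable_caratheodory d (T : measurableType d) (f : T -> R -> R) :
  (forall y, measurable_fun setT (f ^~ y)) -> (forall x, continuous (f x)) ->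
  measurable_fun setT (fun p : T * measurableTypeR R => f p.1 p.2).
Proof.
move=> mf cf.
pose r (n : nat) (y : R) : R := (Num.floor (n.+1%:R * y))%:~R / n.+1%:R.
have cvg_r y : r ^~ y @ \oo --> y.
  apply/cvgrPdist_le => e e0; near=> n.
  have n0 : 0 < n.+1%:R :> R by [].
  have -> : y - r n y = (n.+1%:R * y - (Num.floor (n.+1%:R * y))%:~R) / n.+1%:R.
    by rewrite mulrBl mulrAC mulfV ?mul1r// gt_eqF.
  rewrite normrM normfV (gtr0_norm n0) ler_pdivrMr// ger0_norm ?subr_ge0 ?floor_le//.
  apply: (@le_trans _ _ 1).
    by rewrite lerBlDr addrC -intrD1 ltW// floorD1_gt.
  rewrite -ler_pdivrMl// mulr1; apply: (@le_trans _ _ n%:R); last by rewrite ler_nat.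
  by near: n; exact: nbhs_infty_ger.
apply: (measurable_fun_cvg (h := fun n (p : T * measurableTypeR R) => f p.1 (r n p.2))).
- move=> n _ B mB; rewrite setTI.
  (* Over the strip where y rounds down to k / (n + 1), the function depends on
     x only. *)
  pose A (k : int) : set (T * measurableTypeR R) :=
    ((fun x => f x (k%:~R / n.+1%:R)) @^-1` B) `*`
    [set y : measurableTypeR R | Num.floor (n.+1%:R * (y : R)) = k].
  (* Every integer is a numerator, so the union over rat is the union over int. *)
  rewrite (_ : _ @^-1` B = \bigcup_(q : rat) A (numq q)).
    apply: bigcupT_measurable_rat => q; apply: measurableX.
      by rewrite -[X in measurable X]setTI; exact: mf.
    exact: measurable_floor_level.
  apply/seteqP; split=> [[x y]/= By|[x y] [q _ [/= Bx e]]]; last by rewrite /= /r e.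
  by exists (Num.floor (n.+1%:R * y))%:Q => //; split; rewrite /= numq_int.
- move=> [x y] _ /=; apply: (cvg_comp (r ^~ y) (f x) (cvg_r y)); exact: cf.
Unshelve. all: by end_near. Qed.

Lemma continuous_line (g : quat R -> R) (v w : quat R) : continuous g ->
  continuous (fun s : R => g (s *: v + w)).
Proof.
move=> cg s; apply: (continuous_comp (f := fun s : R => s *: v + w)); last exact: cg.
have h1 := @scalel_continuous _ _ v s.
rewrite /continuous_at in h1 *.
by apply: cvgD; [exact: h1|exact: cvg_cst].
Qed.

(** Caratheodory's criterion, applied to one coordinate after the other. *)
Lemma measurable_point_continuous (g : quat R -> R) : continuous g ->
  measurable_fun setT (fun p : R4 R => g (point p)).
Proof.
move=> cg.
have cl v w := @continuous_line g v w cg.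
have c4 a b c : continuous (fun s => g (mkquat a b c s)).
  rewrite (_ : (fun s => _) = fun s : R =>
    g (s *: mkquat 0 0 0 1 + mkquat a b c 0)); first exact: cl.
  by apply/funext => s; congr g; apply: quatP; rewrite !qcoordE; split; ring.
have c3 a b c : continuous (fun s => g (mkquat a b s c)).
  rewrite (_ : (fun s => _) = fun s : R =>
    g (s *: mkquat 0 0 1 0 + mkquat a b 0 c)); first exact: cl.
  by apply/funext => s; congr g; apply: quatP; rewrite !qcoordE; split; ring.
have c2 a b c : continuous (fun s => g (mkquat a s b c)).
  rewrite (_ : (fun s => _) = fun s : R =>
    g (s *: mkquat 0 1 0 0 + mkquat a 0 b c)); first exact: cl.
  by apply/funext => s; congr g; apply: quatP; rewrite !qcoordE; split; ring.
have c1 a b c : continuous (fun s => g (mkquat s a b c)).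
  rewrite (_ : (fun s => _) = fun s : R =>
    g (s *: mkquat 1 0 0 0 + mkquat 0 a b c)); first exact: cl.
  by apply/funext => s; congr g; apply: quatP; rewrite !qcoordE; split; ring.
apply: (@measurable_caratheodory _ _
  (fun w : measurableTypeR R * measurableTypeR R * measurableTypeR R =>
    fun y => g (mkquat w.1.1 w.1.2 w.2 y))) => [y|w]; last exact: c4.
apply: (@measurable_caratheodory _ _
  (fun w : measurableTypeR R * measurableTypeR R =>
    fun z => g (mkquat w.1 w.2 z y))) => [z|w]; last exact: c3.
apply: (@measurable_caratheodory _ _
  (fun w : measurableTypeR R => fun t => g (mkquat w t z y))) => [t|w]; last exact: c2.
exact: continuous_measurable_fun.
Qed.

End Measurability.

(** * Dilations of Lebesgue measure *)

Section Dilations.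
Local Open Scope ereal_scope.
Variable R : realType.

(** The map s pushes the measure m forward to m / k. *)
Definition dilation d (T : measurableType d) (m : {measure set T -> \bar R})
    (s : T -> T) (k : R) :=
  [/\ measurable_fun setT s, (0 <= k)%R & forall f : T -> \bar R,
    measurable_fun setT f -> (forall x, 0 <= f x) ->
    \int[m]_x f x = k%:E * \int[m]_x f (s x)].

Lemma dilation_integral d (T : measurableType d) (m : {measure set T -> \bar R}) s k
    (f : T -> \bar R) : dilation m s k -> measurable_fun setT f ->
  \int[m]_x f x = \int[m]_x (k%:E * f (s x)).
Proof.
move=> [ms k0 sk] mf; rewrite integralE [RHS]integralE.
have fE : (fun x => f (s x)) = f \o s by [].
rewrite (ge0_funeposM _ k0) (ge0_funenegM _ k0) fE (funepos_comp f s) (funeneg_comp f s).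
have Z g : measurable_fun setT g -> (forall x, 0 <= g x) ->
    \int[m]_x (k%:E * (g \o s) x) = \int[m]_x g x.
  move=> mg g0; rewrite (sk g mg g0); apply: ge0_integralZl => //.
    exact: measurableT_comp.
  by move=> x _; exact: g0.
by rewrite !Z//; [exact: measurable_funeneg|exact: measurable_funepos].
Qed.

Lemma dilation_lebesgue (c : R) : (0 < c)%R ->
  dilation (@lebesgue_measure R) ( *%R c) c.
Proof.
move=> c0; have mc : measurable_fun setT ( *%R c : measurableTypeR R -> measurableTypeR R).
  exact: measurable_funM.
split => //; first exact: ltW.
move=> f mf f0.
pose mu := @lebesgue_measure R.
pose mphi := isMeasurableFun.Build _ _ _ _ _ mc.
pose phi : {mfun measurableTypeR R >-> measurableTypeR R} :=
  HB.pack ( *%R c : measurableTypeR R -> measurableTypeR R) mphi.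
have muE A : measurable A ->
    mu A = mscale (NngNum (ltW c0)) (pushforward mu phi) A.
  apply: lebesgue_measure_unique => _ [[a b] _ <-].
  have pre : ( *%R c : R -> R) @^-1` `]a, b]%classic = `](a / c)%R, (b / c)%R]%classic.
    by apply/seteqP; split=> x /=; rewrite !in_itv/= ltr_pdivrMr// ler_pdivlMr// mulrC.
  rewrite /= /mscale /= /pushforward /= pre lebesgue_measure_itv/= lebesgue_measure_itv/=.
  rewrite !lte_fin ltr_pM2r ?invr_gt0//; case: ifPn => ab; last by rewrite mule0.
  by rewrite -!EFinB -EFinM -mulrBl mulrCA mulfV ?mulr1// gt_eqF.
rewrite (@eq_measure_integral _ _ _ _ (mscale (NngNum (ltW c0)) (pushforward mu phi)))//.
  by rewrite ge0_integral_mscale// ge0_integral_pushforward.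
by move=> A mA _; exact: muE.
Qed.

Lemma dilation_prod d1 d2 (T1 : measurableType d1) (T2 : measurableType d2)
    (m1 : {sigma_finite_measure set T1 -> \bar R})
    (m2 : {sigma_finite_measure set T2 -> \bar R}) s1 s2 k1 k2 :
  dilation m1 s1 k1 -> dilation m2 s2 k2 ->
  dilation (m1 \x m2) (fun p => (s1 p.1, s2 p.2)) (k1 * k2).
Proof.
move=> [ms1 k10 h1] [ms2 k20 h2].
have ms : measurable_fun setT (fun p : T1 * T2 => (s1 p.1, s2 p.2)).
  by apply: measurable_fun_pair; apply: measurableT_comp.
split => //; first exact: mulr_ge0.
move=> f mf f0.
have mfs : measurable_fun setT (fun p : T1 * T2 => f (p.1, s2 p.2)).
  apply: (measurableT_comp mf); apply: measurable_fun_pair => //.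
  exact: measurableT_comp.
have mfss : measurable_fun setT (fun p : T1 * T2 => f (s1 p.1, s2 p.2)).
  by apply: (measurableT_comp mf).
rewrite (fubini_tonelli1 f)// (fubini_tonelli1 (fun p => f (s1 p.1, s2 p.2)))//.
rewrite /fubini_F.
under eq_integral => x _.
  rewrite h2//; last by apply: measurableT_comp.
  over.
have mG := measurable_fun_fubini_tonelli_F (m2 := m2) _ mfs (fun p => f0 _).
rewrite /fubini_F /= in mG.
rewrite ge0_integralZl//; last by move=> x _; exact: integral_ge0.
rewrite (h1 _ mG); last by move=> x; exact: integral_ge0.
by rewrite muleA -EFinM mulrC.
Qed.

End Dilations.

(** * Integrability and Fubini *)

Section Integrability.
Local Open Scope ereal_scope.

Lemma dominated_real d (T : measurableType d) (R : realType)
    (m : {measure set T -> \bar R}) (F D : T -> R) (K : R) :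
  measurable_fun setT F -> m.-integrable setT (fun x => (D x)%:E) ->
  (forall x, (`|F x| <= K * D x)%R) -> m.-integrable setT (fun x => (F x)%:E).
Proof.
move=> mF iD FD; apply: (@le_integrable _ _ _ _ _ measurableT _ (fun x => K%:E * (D x)%:E)).
- exact/measurable_EFinP.
- by move=> x _; rewrite -EFinM !abse_EFin lee_fin (le_trans (FD x))// ler_norm.
- exact: integrableZl.
Qed.

Lemma integrable_prodM d1 d2 (T1 : measurableType d1) (T2 : measurableType d2)
    (R : realType) (m1 : {sigma_finite_measure set T1 -> \bar R})
    (m2 : {sigma_finite_measure set T2 -> \bar R}) (f : T1 -> R) (g : T2 -> R) :
  m1.-integrable setT (fun x => (f x)%:E) -> m2.-integrable setT (fun y => (g y)%:E) ->
  (m1 \x m2).-integrable setT (fun p => (f p.1 * g p.2)%:E).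
Proof.
move=> /integrableP[mf fi] /integrableP[mg gi].
have mf' : measurable_fun setT f by exact/measurable_EFinP.
have mg' : measurable_fun setT g by exact/measurable_EFinP.
apply/integrable12ltyP.
  apply/measurable_EFinP; apply: measurable_funM.
    exact: (measurableT_comp mf' measurable_fst).
  exact: (measurableT_comp mg' measurable_snd).
have e x : \int[m2]_y `|(f x * g y)%:E| = `|(f x)%:E| * \int[m2]_y `|(g y)%:E|.
  rewrite -ge0_integralZl//; last exact: measurableT_comp.
  by apply: eq_integral => y _; rewrite EFinM abseM.
under eq_integral do rewrite /= e.
rewrite ge0_integralZr//; last 2 first.
- exact: measurableT_comp.
- exact: integral_ge0.
by apply: lte_mul_pinfty => //; [exact: integral_ge0|rewrite ge0_fin_numE// integral_ge0].
Qed.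

Lemma sigma_finite_prod d1 d2 (T1 : measurableType d1) (T2 : measurableType d2)
    (R : realType) (m1 : {sigma_finite_measure set T1 -> \bar R})
    (m2 : {sigma_finite_measure set T2 -> \bar R}) : sigma_finite setT (m1 \x m2).
Proof.
have /sigma_finiteP[F [FT Fnd Ffin]] := sigma_finiteT m1.
have /sigma_finiteP[G [GT Gnd Gfin]] := sigma_finiteT m2.
exists (fun n => F n `*` G n) => [|n].
  apply/seteqP; split=> [[x y] _|//].
  have [i _ Fx] : (\bigcup_n F n) x by rewrite -FT.
  have [j _ Gy] : (\bigcup_n G n) y by rewrite -GT.
  exists (maxn i j) => //; split => /=.
    by move/subsetPset: (Fnd _ _ (leq_maxl i j)); exact.
  by move/subsetPset: (Gnd _ _ (leq_maxr i j)); exact.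
have [mF oF] := Ffin n; have [mG oG] := Gfin n; split; first exact: measurableX.
by rewrite product_measure1E// lte_mul_pinfty// ge0_fin_numE.
Qed.

(** The product of two sigma-finite measures, bundled with its sigma-finiteness
    so that products can be iterated. *)
Definition prod_sigma_finite d1 d2 (T1 : measurableType d1) (T2 : measurableType d2)
    (R : realType) (m1 : {sigma_finite_measure set T1 -> \bar R})
    (m2 : {sigma_finite_measure set T2 -> \bar R}) :
    {sigma_finite_measure set (T1 * T2)%type -> \bar R} :=
  HB.pack (m1 \x m2) (Measure_isSigmaFinite.Build _ _ _ (m1 \x m2) (sigma_finite_prod m1 m2)).

Lemma fubini_zero1 d1 d2 (T1 : measurableType d1) (T2 : measurableType d2)
    (R : realType) (m1 : {sigma_finite_measure set T1 -> \bar R})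
    (m2 : {sigma_finite_measure set T2 -> \bar R}) (f : T1 * T2 -> \bar R) :
  (m1 \x m2).-integrable setT f -> (forall x, \int[m2]_y f (x, y) = 0) ->
  \int[m1 \x m2]_p f p = 0.
Proof.
move=> fi f0; rewrite -integral12_prod_meas1//.
by rewrite integral0_eq// => x _; exact: f0.
Qed.

Lemma fubini_zero2 d1 d2 (T1 : measurableType d1) (T2 : measurableType d2)
    (R : realType) (m1 : {sigma_finite_measure set T1 -> \bar R})
    (m2 : {sigma_finite_measure set T2 -> \bar R}) (f : T1 * T2 -> \bar R) :
  (m1 \x m2).-integrable setT f -> (forall y, \int[m1]_x f (x, y) = 0) ->
  \int[m1 \x m2]_p f p = 0.
Proof.
move=> fi f0; rewrite -integral21_prod_meas1//.
by rewrite integral0_eq// => x _; exact: f0.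
Qed.

Lemma integrable_oneDsqrV (R : realType) :
  (@lebesgue_measure R).-integrable setT (fun x => ((oneDsqr x)^-1)%R%:E).
Proof.
apply/integrableP; split.
  apply/measurable_EFinP; apply: continuous_measurable_fun.
  exact: continuous_oneDsqrV.
under eq_integral do rewrite abse_EFin ger0_norm ?invr_ge0 ?oneDsqr_ge0//.
rewrite (@ge0_symfun_integralT _ (fun x => (oneDsqr x)^-1)%R); last 3 first.
- by move=> x; rewrite invr_ge0.
- exact: continuous_oneDsqrV.
- by move=> x; rewrite /= /oneDsqr sqrrN.
rewrite (_ : [set x | _] = `[0%R, +oo[%classic).
  by rewrite integral0y_oneDsqr ltry.
by apply/seteqP; split=> x /=; rewrite in_itv/= andbT.
Qed.

Lemma integrable_weight (R : realType) (c : R) : (0 < c)%R ->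
  (@lebesgue_measure R).-integrable setT (fun x => ((1 + c * x ^+ 2)^-1)%R%:E).
Proof.
move=> c0.
have h x : (0 < 1 + c * x ^+ 2)%R by rewrite ltr_pwDl// mulr_ge0 ?sqr_ge0// ltW.
apply: (dominated_real (K := (1 + c^-1)%R) _ (@integrable_oneDsqrV R)).
  apply: continuous_measurable_fun => x; apply: cvgV; first by rewrite gt_eqF.
  apply: cvgD; first exact: cvg_cst.
  by apply: cvgM; [exact: cvg_cst|exact: exprn_continuous].
move=> x; rewrite ger0_norm; last by rewrite invr_ge0 ltW.
have h1 : (0 < oneDsqr x)%R by rewrite (lt_le_trans ltr01)// oneDsqr_ge1.
rewrite -[leLHS]mul1r ler_pdivrMr// mulrAC ler_pdivlMr// mul1r /oneDsqr.
have -> : ((1 + c^-1) * (1 + c * x ^+ 2) = 1 + x ^+ 2 + (c^-1 + c * x ^+ 2))%R.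
  by field; rewrite gt_eqF.
rewrite lerDl; apply: addr_ge0; first by rewrite invr_ge0 ltW.
by rewrite mulr_ge0 ?sqr_ge0// ltW.
Qed.

(** The integral over [-n, n] is F n - F (- n). *)
Lemma integral_derivative_zero (R : realType) (F f : R -> R) :
  continuous f -> (forall x : R, is_derive x 1%R F (f x)) ->
  (@lebesgue_measure R).-integrable setT (fun x => (f x)%:E) ->
  F n%:R @[n --> \oo] --> (0 : R)%R -> F (- n%:R)%R @[n --> \oo] --> (0 : R)%R ->
  \int[@lebesgue_measure R]_x (f x)%:E = 0.
Proof.
move=> cf dF fi Fy FNy; set mu := @lebesgue_measure R.
pose D (n : nat) := `[(- n%:R)%R : R, n%:R]%classic.
have mf : measurable_fun setT (fun x => (f x)%:E).
  by apply/measurable_EFinP; exact: continuous_measurable_fun.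
pose f_ n x : \bar R := ((EFin \o f) \_ (D n)) x.
have iD n : \int[mu]_x f_ n.+1 x = (F n.+1%:R - F (- n.+1%:R))%:E.
  rewrite /f_ -integral_mkcond /D EFinB; apply: continuous_FTC2.
  - by rewrite -subr_gt0 opprK addr_gt0.
  - exact: continuous_subspaceT.
  - have cF : continuous F.
      move=> x; apply: differentiable_continuous; apply/derivable1_diffP.
      by case: (dF x).
    split=> [x _||]; first by case: (dF x).
      by apply: cvg_at_right_filter; exact: cF.
    by apply: cvg_at_left_filter; exact: cF.
  - by move=> x _; rewrite derive1E; case: (dF x).
(* The truncations of f to [-n, n] are dominated by |f|. *)
have [] := @dominated_convergence _ _ _ mu setT measurableT f_ (fun x => (f x)%:E)
  (fun x => `|(f x)%:E|).
- move=> n; apply/measurable_restrict => //; first exact: measurable_itv.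
  exact: measurable_funS mf.
- exact: mf.
- apply: aeW => x _; apply: cvg_near_cst; near=> n.
  rewrite /f_ patchE ifT// inE /D/= in_itv/=.
  by rewrite -ler_norml; near: n; exact: nbhs_infty_ger.
- exact: integrable_abse.
- apply: aeW => x n _; rewrite /f_ patchE; case: ifP => // _.
  by rewrite abse0.
move=> _ _ h.
have h0 : [sequence \int[mu]_x f_ n x]_n @ \oo --> (0 : \bar R).
  rewrite -(cvg_shiftn 1); apply: cvg_trans.
    apply: near_eq_cvg; apply: nearW => n /=; rewrite addn1 iD; reflexivity.
  apply: cvg_EFin; first by apply: nearW.
  rewrite -[X in _ --> X](subrr 0%R).
  have Fy1 : F n.+1%:R @[n --> \oo] --> (0 : R)%R.
    by rewrite (cvg_shiftS (fun n => F n%:R)).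
  have FNy1 : F (- n.+1%:R)%R @[n --> \oo] --> (0 : R)%R.
    by rewrite (cvg_shiftS (fun n => F (- n%:R)%R)).
  exact: cvgB Fy1 FNy1.
exact: (cvg_unique _ h h0).
Unshelve. all: by end_near. Qed.

End Integrability.

(** * The Chern density and the curvature density *)

Section Densities.
Variable R : realType.
Implicit Types (C s u : R) (x : quat R).

Definition quad s : R := s ^+ 2 + 4 * s + 1.

(** The Chern density is the divergence of the vector field C^2 flux(C|x|^2) x. *)
Definition flux s : R := 108 * (1 + s) ^+ 2 / quad s ^+ 3.
Definition dflux s : R := 216 * (1 + s) / quad s ^+ 3 -
  324 * (1 + s) ^+ 2 * (2 * s + 4) / quad s ^+ 4.

(** The i-th partial derivative of x_i flux(C|x|^2). *)
Definition partial_flux C (i : 'I_4) x : R :=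
  flux (C * qnorm2 x) + 2 * (C * x 0 i ^+ 2) * dflux (C * qnorm2 x).

(** The squared norm of the curvature for C = 1, as a function of |x|^2. *)
Definition energy s : R :=
  108 * ((1 - s ^+ 2) ^+ 2 + (s ^+ 2 + s + 1) ^+ 2) / quad s ^+ 4.

Lemma den_quad C u : den C u = quad (C * u).
Proof. by rewrite /den /quad; ring. Qed.

Lemma quad_ge s : 0 <= s -> (1 + s) ^+ 2 <= quad s.
Proof. by move=> s0; rewrite /quad; nra. Qed.

Lemma quad_gt0 s : 0 <= s -> 0 < quad s.
Proof. by move=> s0; rewrite (lt_le_trans _ (quad_ge s0))// exprn_gt0// ltr_pwDl. Qed.

Lemma is_derive_quad s : is_derive s 1 quad (2 * s + 4).
Proof.
rewrite (_ : quad = (id ^+ 2 + cst 4 * id + cst 1))//.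
by apply: is_derive_eq; rewrite /GRing.scale /=; ring.
Qed.

Lemma is_derive_flux s : 0 <= s -> is_derive s 1 flux (dflux s).
Proof.
move=> s0; have d0 : quad s != 0 by rewrite gt_eqF// quad_gt0.
have d3 : (quad ^+ 3) s != 0 by rewrite exprfctE expf_neq0.
have h1 : is_derive s 1 (fun v : R => 108 * (1 + v) ^+ 2) (216 * (1 + s)).
  rewrite (_ : (fun v : R => _) = cst 108 * (cst 1 + id) ^+ 2)//.
  by apply: is_derive_eq; rewrite /GRing.scale /= !fctE /=; ring.
have := is_deriveM h1 (is_derive_inv d3 (is_deriveX 3 (is_derive_quad s))).
move/is_derive_eq; apply; rewrite /dflux /GRing.scale /= !fctE.
by field.
Qed.

(** In terms of the profile f, the density is 48 (f - u f^2)(f + u f') with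
    u = |x|^2, which is the divergence of (12 f^2 - 8 u f^3) x. *)
Lemma chern_densityE C x : 0 <= C ->
  chern_density (kwA C) x = C ^+ 2 * \sum_i partial_flux C i x.
Proof.
move=> C0; set u := qnorm2 x; have u0 : 0 <= u by exact: qnorm2_ge0.
have s0 : 0 <= C * u by exact: mulr_ge0.
have d0 : quad (C * u) != 0 by rewrite gt_eqF// quad_gt0.
have dd : den C u != 0 by rewrite den_quad.
rewrite /chern_density /qtr kwAE.
have hf := radial_comp (is_derive_profA dd).
rewrite (q1_wedge_sq (fun S => curvature_radial S hf)) -/u.
have -> : \sum_i partial_flux C i x = 4 * flux (C * u) + 2 * (C * u) * dflux (C * u).
  have uE : u = x 0 o0 ^+ 2 + x 0 o1 ^+ 2 + x 0 o2 ^+ 2 + x 0 o3 ^+ 2.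
    by rewrite /u /qnorm2 big_ord4.
  rewrite big_ord4 /partial_flux -/u; move: (flux _) (dflux _) => a b.
  by rewrite uE; ring.
rewrite /profA /dprofA den_quad /flux /dflux; move: d0; rewrite /quad => d0.
by field; rewrite exprMn in d0 *.
Qed.

Lemma fnorm_curvatureE C x : 0 <= C ->
  fnorm (curvature (kwA C)) x ^+ 2 = C ^+ 2 * energy (C * qnorm2 x).
Proof.
move=> C0; set u := qnorm2 x; have u0 : 0 <= u by exact: qnorm2_ge0.
have s0 : 0 <= C * u by exact: mulr_ge0.
have d0 : quad (C * u) != 0 by rewrite gt_eqF// quad_gt0.
have dd : den C u != 0 by rewrite den_quad.
rewrite kwAE.
have hf := radial_comp (is_derive_profA dd).
rewrite (fnorm_sqr (fun S => curvature_radial S hf)) -/u.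
rewrite /profA /dprofA den_quad /energy; move: d0; rewrite /quad => d0.
by field; rewrite exprMn in d0 *.
Qed.

End Densities.

Section Bounds.
Variable R : realType.
Implicit Types (C s u : R) (x : quat R).

Lemma flux_bound s : 0 <= s -> `|flux s| <= 108 / (1 + s) ^+ 4.
Proof.
move=> s0; have e0 := quad_gt0 s0; have ae := quad_ge s0.
have a0 : 0 < 1 + s by rewrite ltr_pwDl.
have e3 : (1 + s) ^+ 6 <= quad s ^+ 3
  by rewrite (exprM _ 2 3) lerXn2r ?nnegrE ?exprn_ge0 ?(ltW e0) ?(ltW a0).
rewrite ger0_norm; last by rewrite /flux !mulr_ge0 ?invr_ge0 ?exprn_ge0 ?(ltW e0) ?(ltW a0).
rewrite /flux ler_pdivrMr ?exprn_gt0// [leRHS]mulrAC ler_pdivlMr ?exprn_gt0//.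
by rewrite -mulrA -exprD ler_pM2l.
Qed.

Lemma dflux_bound s : 0 <= s -> `|s * dflux s| <= 1512 / (1 + s) ^+ 4.
Proof.
move=> s0; have e0 := quad_gt0 s0; have ae := quad_ge s0.
have a0 : 0 < 1 + s by rewrite ltr_pwDl.
set a := 1 + s in ae a0 *; set e := quad s in e0 ae *.
have e3 : a ^+ 6 <= e ^+ 3
  by rewrite (exprM _ 2 3) lerXn2r ?nnegrE ?exprn_ge0 ?(ltW e0) ?(ltW a0).
have e4 : a ^+ 8 <= e ^+ 4
  by rewrite (exprM _ 2 4) lerXn2r ?nnegrE ?exprn_ge0 ?(ltW e0) ?(ltW a0).
have h1 : 0 <= 216 * s * a / e ^+ 3 <= 216 / a ^+ 4.
  apply/andP; split; first by rewrite !mulr_ge0 ?invr_ge0 ?exprn_ge0 ?(ltW e0) ?(ltW a0).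
  rewrite ler_pdivrMr ?exprn_gt0// [leRHS]mulrAC ler_pdivlMr ?exprn_gt0//.
  apply: (@le_trans _ _ (216 * a ^+ 6)); last by apply: ler_wpM2l; [rewrite ler0n|].
  have -> : 216 * s * a * a ^+ 4 = 216 * (s * a ^+ 5) by ring.
  rewrite ler_pM2l// [leRHS]exprS ler_pM2r ?exprn_gt0//; rewrite /a; lra.
have h2 : 0 <= 324 * s * a ^+ 2 * (2 * s + 4) / e ^+ 4 <= 1296 / a ^+ 4.
  apply/andP; split.
    by rewrite !mulr_ge0 ?addr_ge0 ?mulr_ge0 ?invr_ge0 ?exprn_ge0 ?(ltW e0) ?(ltW a0).
  rewrite ler_pdivrMr ?exprn_gt0// [leRHS]mulrAC ler_pdivlMr ?exprn_gt0//.
  apply: (@le_trans _ _ (1296 * a ^+ 8)); last by apply: ler_wpM2l; [rewrite ler0n|].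
  have -> : 324 * s * a ^+ 2 * (2 * s + 4) * a ^+ 4 = (324 * s * (2 * s + 4)) * a ^+ 6 by ring.
  have -> : 1296 * a ^+ 8 = (1296 * a ^+ 2) * a ^+ 6 by ring.
  rewrite ler_pM2r ?exprn_gt0//; have := sqr_ge0 s; rewrite /a; lra.
have -> : s * dflux s = 216 * s * a / e ^+ 3 - 324 * s * a ^+ 2 * (2 * s + 4) / e ^+ 4.
  by rewrite /dflux -/a -/e; ring.
have -> : 1512 / a ^+ 4 = 216 / a ^+ 4 + 1296 / a ^+ 4 by ring.
case/andP: h1 => h10 h11; case/andP: h2 => h20 h21.
by rewrite ler_norml; apply/andP; split; lra.
Qed.

Lemma energy_gt0 s : 0 <= s -> 0 < energy s.
Proof.
move=> s0; rewrite /energy divr_gt0 ?exprn_gt0 ?quad_gt0// mulr_gt0//.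
rewrite ltr_wpDl ?sqr_ge0// exprn_gt0//; nra.
Qed.

Lemma energy_bound s : 0 <= s -> energy s <= 216 / (1 + s) ^+ 4.
Proof.
move=> s0; have e0 := quad_gt0 s0; have ae := quad_ge s0.
have a0 : 0 < 1 + s by rewrite ltr_pwDl.
have e4 : (1 + s) ^+ 8 <= quad s ^+ 4
  by rewrite (exprM _ 2 4) lerXn2r ?nnegrE ?exprn_ge0 ?(ltW e0) ?(ltW a0).
rewrite /energy ler_pdivrMr ?exprn_gt0// [leRHS]mulrAC ler_pdivlMr ?exprn_gt0//.
apply: (@le_trans _ _ (216 * (1 + s) ^+ 8)); last by rewrite ler_pM2l.
rewrite (exprD _ 4 4) mulrA ler_pM2r ?exprn_gt0//.
have h1 : (1 - s ^+ 2) ^+ 2 <= (1 + s) ^+ 4.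
  rewrite (exprM _ 2 2) -[leRHS]real_normK ?num_real// -[leLHS]real_normK ?num_real//.
  rewrite lerXn2r// ?nnegrE// [leRHS]ger0_norm ?sqr_ge0// ler_norml; apply/andP; split; nra.
have h2 : (s ^+ 2 + s + 1) ^+ 2 <= (1 + s) ^+ 4.
  rewrite (exprM _ 2 2) lerXn2r ?nnegrE ?sqr_ge0//; nra.
lra.
Qed.

Lemma partial_flux_bound C i x : 0 <= C ->
  `|partial_flux C i x| <= 3132 / (1 + C * qnorm2 x) ^+ 4.
Proof.
move=> C0; set s := C * qnorm2 x; have s0 : 0 <= s by rewrite mulr_ge0 ?qnorm2_ge0.
have hs : C * x 0 i ^+ 2 <= s.
  rewrite ler_wpM2l// /qnorm2 (bigD1 i)//= lerDl; apply: sumr_ge0 => j _; exact: sqr_ge0.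
rewrite /partial_flux -/s (le_trans (ler_normD _ _))//.
have -> : 3132 / (1 + s) ^+ 4 = 108 / (1 + s) ^+ 4 + 2 * (1512 / (1 + s) ^+ 4) by ring.
apply: lerD; first exact: flux_bound.
rewrite -mulrA normrM (@gtr0_norm _ 2)// ler_pM2l//.
apply: le_trans (dflux_bound s0); rewrite (normrM _ (dflux s)) [leRHS]normrM ler_wpM2r//.
rewrite (ger0_norm s0) ger0_norm //; apply: mulr_ge0 => //; exact: sqr_ge0.
Qed.

(** Each of the four factors is at least the inverse of 1 + C|x|^2. The right-hand
    side is a product of integrable functions of one variable. *)
Lemma prod_bound C x : 0 <= C -> ((1 + C * qnorm2 x) ^+ 4)^-1 <=
  (1 + C * q1 x ^+ 2)^-1 * (1 + C * qI x ^+ 2)^-1 * (1 + C * qJ x ^+ 2)^-1 *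
  (1 + C * qK x ^+ 2)^-1.
Proof.
move=> C0; have h y : 0 < 1 + C * y ^+ 2 by rewrite ltr_pwDl// mulr_ge0// sqr_ge0.
have h4 : 0 < 1 + C * qnorm2 x by rewrite ltr_pwDl// mulr_ge0 ?qnorm2_ge0.
rewrite -!invfM lef_pV2 ?posrE ?exprn_gt0 ?mulr_gt0 ?h//.
have := sqr_ge0 (q1 x); have := sqr_ge0 (qI x).
have := sqr_ge0 (qJ x); have := sqr_ge0 (qK x) => k0 j0 i0 l0.
have hb y : y ^+ 2 <= qnorm2 x -> 1 + C * y ^+ 2 <= 1 + C * qnorm2 x.
  by move=> yx; rewrite lerD2l ler_wpM2l.
have pm (a a' b b' : R) : 0 < a -> 0 < b -> a <= a' -> b <= b' -> a * b <= a' * b'.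
  by move=> *; apply: ler_pM => //; exact: ltW.
have -> : (1 + C * qnorm2 x) ^+ 4 = (1 + C * qnorm2 x) * (1 + C * qnorm2 x) *
  (1 + C * qnorm2 x) * (1 + C * qnorm2 x) by ring.
have [e1 e2 e3 e4] : [/\ q1 x ^+ 2 <= qnorm2 x, qI x ^+ 2 <= qnorm2 x,
    qJ x ^+ 2 <= qnorm2 x & qK x ^+ 2 <= qnorm2 x] by rewrite qnorm2E; split; lra.
have p2 := mulr_gt0 (h (q1 x)) (h (qI x)).
apply: (pm _ _ _ _ (mulr_gt0 p2 (h _)) (h _) _ (hb _ e4)).
apply: (pm _ _ _ _ p2 (h _) _ (hb _ e3)).
exact: (pm _ _ _ _ (h _) (h _) (hb _ e1) (hb _ e2)).
Qed.

Lemma regular_quad C : regular setT (fun x : quat R => quad (C * qnorm2 x)).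
Proof.
apply: (regular_ext (f := fun x => den C (qnorm2 x))) (regular_den _ _) => x _.
by rewrite den_quad.
Qed.

Lemma quad_neq0 C x : 0 <= C -> quad (C * qnorm2 x) != 0.
Proof. by move=> C0; rewrite gt_eqF// quad_gt0// mulr_ge0 ?qnorm2_ge0. Qed.

Lemma regular_quadV C n : 0 <= C -> regular setT (fun x : quat R => (quad (C * qnorm2 x) ^+ n)^-1).
Proof.
move=> C0; apply: regular_inv => [x _|]; first by rewrite expf_neq0// quad_neq0.
by apply: regular_exp; exact: regular_quad.
Qed.

Lemma regular_s C : regular setT (fun x : quat R => C * qnorm2 x).
Proof. by apply: regular_mul; [exact: regular_cst|exact: regular_qnorm2]. Qed.

Lemma continuous_partial_flux C i : 0 <= C -> continuous (partial_flux C i).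
Proof.
move=> C0; apply: regular_continuous; rewrite /partial_flux /flux /dflux.
have rs := regular_s C; have rV n := regular_quadV n C0.
have r1 : regular setT (fun x : quat R => 1 + C * qnorm2 x).
  by apply: regular_add => //; exact: regular_cst.
apply: regular_add.
  apply: regular_mul => //; apply: regular_mul; first exact: regular_cst.
  exact: regular_exp.
apply: regular_mul.
  apply: regular_mul; first exact: regular_cst.
  apply: regular_mul; first exact: regular_cst.
  by apply: regular_exp; exact: regular_coord.
apply: regular_add.
  by apply: regular_mul => //; apply: regular_mul => //; exact: regular_cst.
apply: regular_opp; apply: regular_mul => //; apply: regular_mul.
  by apply: regular_mul; [exact: regular_cst|exact: regular_exp].
apply: regular_add; last exact: regular_cst.
by apply: regular_mul => //; exact: regular_cst.
Qed.

Lemma continuous_energy C : 0 <= C -> continuous (fun x : quat R => energy (C * qnorm2 x)).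
Proof.
move=> C0; apply: regular_continuous; rewrite /energy.
have rs := regular_s C.
apply: regular_mul; last exact: regular_quadV.
apply: regular_mul; first exact: regular_cst.
apply: regular_add; apply: regular_exp.
  apply: regular_add; first exact: regular_cst.
  by apply: regular_opp; exact: regular_exp.
apply: regular_add; last exact: regular_cst.
by apply: regular_add => //; exact: regular_exp.
Qed.

End Bounds.

(** * Integrals over R^4 *)

Section FourDim.
Variable R : realType.
Notation mu := (@lebesgue_measure R).
Notation T := (measurableTypeR R).
Implicit Types (C : R) (x : quat R).

(** As a function on sets, mu4 is lebesgue4; the bundled form makes Fubini apply
    at each stage. *)
Definition mu2 := prod_sigma_finite mu mu.
Definition mu3 := prod_sigma_finite mu2 mu.
Definition mu4 := prod_sigma_finite mu3 mu.

Definition weight C (y : R) : R := (1 + C * y ^+ 2)^-1.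
Definition weight4 C (p : R4 R) : R :=
  weight C p.1.1.1 * weight C p.1.1.2 * weight C p.1.2 * weight C p.2.

Lemma weight_ge0 C y : 0 <= C -> 0 <= weight C y.
Proof. by move=> C0; rewrite invr_ge0 addr_ge0// mulr_ge0 ?sqr_ge0. Qed.

Lemma pointE (p : R4 R) : (q1 (point p) = p.1.1.1) * (qI (point p) = p.1.1.2) *
  (qJ (point p) = p.1.2) * (qK (point p) = p.2).
Proof. by rewrite /point !mkquatE. Qed.

Lemma integrable_weight2 C : 0 < C ->
  (mu \x mu)%E.-integrable setT (fun p => (weight C p.1 * weight C p.2)%:E).
Proof. by move=> C0; apply: integrable_prodM; exact: integrable_weight. Qed.

Lemma integrable_weight3 C : 0 < C ->
  ((mu \x mu) \x mu)%E.-integrable setT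
    (fun p => (weight C p.1.1 * weight C p.1.2 * weight C p.2)%:E).
Proof.
move=> C0; have h2 := integrable_weight2 C0; have h1 := integrable_weight C0.
exact: (@integrable_prodM _ _ (T * T)%type T R mu2 mu
  (fun p : R * R => weight C p.1 * weight C p.2) (weight C) h2 h1).
Qed.

Lemma integrable_weight4 C : 0 < C ->
  (@lebesgue4 R).-integrable setT (fun p => (weight4 C p)%:E).
Proof.
move=> C0; have h3 := integrable_weight3 C0; have h1 := integrable_weight C0.
exact: (@integrable_prodM _ _ (T * T * T)%type T R mu3 mu
  (fun p : R * R * R => weight C p.1.1 * weight C p.1.2 * weight C p.2) (weight C) h3 h1).
Qed.

Lemma integrable_dominated4 C K (G : quat R -> R) : 0 < C -> continuous G ->
  (forall x, `|G x| <= K / (1 + C * qnorm2 x) ^+ 4) ->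
  (@lebesgue4 R).-integrable setT (fun p => (G (point p))%:E).
Proof.
move=> C0 cG GK; have K0 : 0 <= K.
  have := GK 0; rewrite qnorm2E !qcoord0 expr0n/= !addr0 mulr0 addr0 expr1n divr1.
  exact: le_trans.
have mG := measurable_point_continuous cG; have iD := integrable_weight4 C0.
apply: (@dominated_real _ _ R mu4 (fun p => G (point p)) (weight4 C) K mG iD) => p.
rewrite (le_trans (GK _))// ler_wpM2l//.
by rewrite (le_trans (prod_bound _ (ltW C0)))// !pointE.
Qed.

(** Fubini, integrating along the i-th axis first. The bound makes the function
    integrable on all the lower-dimensional slices met on the way. *)
Lemma integral4_zero C K (G : quat R -> R) (i : 'I_4) : 0 < C -> continuous G ->
  (forall x, `|G x| <= K / (1 + C * qnorm2 x) ^+ 4) ->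
  (forall w : quat R, w 0 i = 0 -> (\int[mu]_s (G (s *: qbasis R i + w))%:E = 0)%E) ->
  (\int[@lebesgue4 R]_p (G (point p))%:E = 0)%E.
Proof.
move=> C0 cG GK G0.
have K0 : 0 <= K.
  have := GK 0; rewrite qnorm2E !qcoord0 expr0n/= !addr0 mulr0 addr0 expr1n divr1.
  exact: le_trans.
have iG : mu4.-integrable setT (fun p => (G (point p))%:E) := integrable_dominated4 C0 cG GK.
have mG := measurable_point_continuous cG.
have Gd p : `|G (point p)| <= K * weight4 C p.
  rewrite (le_trans (GK _))// ler_wpM2l//.
  by rewrite (le_trans (prod_bound _ (ltW C0)))// !pointE.
have slice (h : R -> quat R) (w : quat R) : w 0 i = 0 -> (forall s, h s = s *: qbasis R i + w) ->
    (\int[mu]_s (G (h s))%:E = 0)%E.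
  by move=> w0 hw; rewrite -[RHS](G0 w w0); apply: eq_integral => s _; rewrite hw.
have d0 y := weight_ge0 y (ltW C0).
have m3 e : measurable_fun setT (fun p : R * R * R => G (point (p, e))).
  exact: (measurableT_comp mG (measurable_pair2 _)).
have i3 e : mu3.-integrable setT (fun p => (G (point (p, e)))%:E).
  apply: (@dominated_real _ _ R mu3 _ _ (K * weight C e) (m3 e) (integrable_weight3 C0)) => p.
  rewrite (le_trans (Gd _))// /weight4 /= le_eqVlt; apply/orP; left; apply/eqP; ring.
have m2 d e : measurable_fun setT (fun p : R * R => G (point (p, d, e))).
  exact: (measurableT_comp (m3 e) (measurable_pair2 _)).
have i2 d e : mu2.-integrable setT (fun p => (G (point (p, d, e)))%:E).
  apply: (@dominated_real _ _ R mu2 _ _ (K * weight C e * weight C d) (m2 d e)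
    (integrable_weight2 C0)) => p.
  rewrite (le_trans (Gd _))// /weight4 /= le_eqVlt; apply/orP; left; apply/eqP; ring.
elim/ord4_ind: i slice {G0} => slice.
- apply: (@fubini_zero2 _ _ _ T R mu3 mu _ iG) => e.
  apply: (@fubini_zero2 _ _ _ T R mu2 mu _ (i3 e)) => d.
  apply: (@fubini_zero2 _ _ T T R mu mu _ (i2 d e)) => b.
  apply: (slice _ (mkquat 0 b d e)) => [|s]; first by rewrite -[LHS]/(q1 _) mkquatE.
  by apply: quatP; rewrite qbasisE !qcoordE ?pointE /=; split; ring.
- apply: (@fubini_zero2 _ _ _ T R mu3 mu _ iG) => e.
  apply: (@fubini_zero2 _ _ _ T R mu2 mu _ (i3 e)) => d.
  apply: (@fubini_zero1 _ _ T T R mu mu _ (i2 d e)) => a.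
  apply: (slice _ (mkquat a 0 d e)) => [|s]; first by rewrite -[LHS]/(qI _) mkquatE.
  by apply: quatP; rewrite qbasisE !qcoordE ?pointE /=; split; ring.
- apply: (@fubini_zero2 _ _ _ T R mu3 mu _ iG) => e.
  apply: (@fubini_zero1 _ _ _ T R mu2 mu _ (i3 e)) => -[a b].
  apply: (slice _ (mkquat a b 0 e)) => [|s]; first by rewrite -[LHS]/(qJ _) mkquatE.
  by apply: quatP; rewrite qbasisE !qcoordE ?pointE /=; split; ring.
- apply: (@fubini_zero1 _ _ _ T R mu3 mu _ iG) => -[[a b] d].
  apply: (slice _ (mkquat a b d 0)) => [|s]; first by rewrite -[LHS]/(qK _) mkquatE.
  by apply: quatP; rewrite qbasisE !qcoordE ?pointE /=; split; ring.
Qed.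

Definition scale4 (c : R) (p : R4 R) : R4 R := (c * p.1.1.1, c * p.1.1.2, c * p.1.2, c * p.2).

Lemma point_scale4 c p : point (scale4 c p) = c *: point p.
Proof. by apply: quatP; rewrite !qcoordE ?pointE. Qed.

Lemma dilation_lebesgue4 c : 0 < c -> dilation (@lebesgue4 R) (scale4 c) (c * c * c * c).
Proof.
move=> c0; have h := dilation_lebesgue c0.
have h2 := @dilation_prod R _ _ T T mu mu _ _ _ _ h h.
have h3 := @dilation_prod R _ _ (T * T)%type T mu2 mu _ _ _ _ h2 h.
exact: (@dilation_prod R _ _ (T * T * T)%type T mu3 mu _ _ _ _ h3 h).
Qed.

End FourDim.

(** * The instanton number *)

Section Instanton.
Variable R : realType.
Implicit Types (C : R) (x : quat R).

(** With a = |w|^2, the integrand is the derivative of s flux(C (s^2 + a)), which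
    tends to 0 at both ends. *)
Lemma partial_flux_slice C (i : 'I_4) (w : quat R) : 0 < C -> w 0 i = 0 ->
  (\int[@lebesgue_measure R]_s (partial_flux C i (s *: qbasis R i + w))%:E = 0)%E.
Proof.
move=> C0 wi; pose a := qnorm2 w; have a0 : 0 <= a by exact: qnorm2_ge0.
have coordE (s : R) : (s *: qbasis R i + w) 0 i = s.
  by rewrite !mxE !eqxx mulr1 wi addr0.
have normE (s : R) : qnorm2 (s *: qbasis R i + w) = s ^+ 2 + a.
  rewrite /a /qnorm2 (bigD1 i)//= coordE [in RHS](bigD1 i)//= wi expr0n add0r.
  by congr (_ + _); apply: eq_bigr => j /negPf ji; rewrite !mxE eqxx ji mulr0 add0r.
pose F (s : R) := s * flux (C * (s ^+ 2 + a)).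
have u0 (s : R) : 0 <= s ^+ 2 + a by rewrite addr_ge0// sqr_ge0.
have Cu0 (s : R) : 0 <= C * (s ^+ 2 + a) by rewrite mulr_ge0// ltW.
have s1 (s : R) : 0 < 1 + C * s ^+ 2 by rewrite ltr_pwDl// mulr_ge0 ?sqr_ge0// ltW.
have domE (s : R) : ((1 + C * (s ^+ 2 + a)) ^+ 4)^-1 <= (1 + C * s ^+ 2)^-1.
  have h : 1 + C * s ^+ 2 <= 1 + C * (s ^+ 2 + a) by rewrite lerD2l ler_pM2l// lerDl.
  have h1 : 1 <= 1 + C * (s ^+ 2 + a) by rewrite lerDl.
  rewrite lef_pV2 ?posrE ?exprn_gt0 ?s1 ?(lt_le_trans ltr01 h1)//.
  by rewrite (le_trans h)// -[leLHS]expr1 ler_weXn2l.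
have Fbound (e s : R) : 0 < e -> 108 / (C * e) <= `|s| -> `|F s| <= e.
  move=> e0 hs; rewrite normrM.
  apply: (@le_trans _ _ (`|s| * (108 * (1 + C * s ^+ 2)^-1))).
    rewrite ler_wpM2l//; apply: le_trans (flux_bound (Cu0 s)) _.
    by rewrite ler_wpM2l ?ler0n.
  rewrite mulrA ler_pdivrMr//.
  apply: (@le_trans _ _ (e * (C * s ^+ 2))); last first.
    by rewrite ler_pM2l// lerDr.
  rewrite -[s ^+ 2]real_normK ?num_real// expr2.
  move: hs; rewrite ler_pdivrMr ?mulr_gt0// => hs.
  have -> : e * (C * (`|s| * `|s|)) = `|s| * (`|s| * (C * e)) by ring.
  by rewrite ler_wpM2l.
have cvgF (h : nat -> R) : (forall n, `|h n| = n%:R) -> F (h n) @[n --> \oo] --> (0 : R).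
  move=> hn; apply/cvgrPdist_le => e e0; near=> n.
  rewrite sub0r normrN Fbound// hn; near: n; exact: nbhs_infty_ger.
apply: (@integral_derivative_zero R F (fun s : R => partial_flux C i (s *: qbasis R i + w))).
- by apply: continuous_line; apply: continuous_partial_flux; exact: ltW.
- move=> s; have h1 : is_derive s 1 (fun v : R => C * (v ^+ 2 + a)) (2 * C * s).
    rewrite (_ : (fun v : R => _) = cst C * (id ^+ 2 + cst a))//.
    by apply: is_derive_eq; rewrite /GRing.scale /= !fctE /=; ring.
  have h2 := is_derive_comp h1 (is_derive_flux (Cu0 s)).
  have := is_deriveM (is_derive_id s (1 : R)) h2.
  move/is_derive_eq; apply.
  by rewrite /partial_flux normE coordE /GRing.scale /=; ring.
- apply: (dominated_real (K := 3132) _ (integrable_weight C0)).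
    apply: continuous_measurable_fun; apply: continuous_line.
    by apply: continuous_partial_flux; exact: ltW.
  move=> s; apply: le_trans (partial_flux_bound _ _ (ltW C0)) _.
  by rewrite normE ler_wpM2l ?ler0n.
- by apply: (cvgF (fun n => n%:R)) => n; rewrite ger0_norm.
- by apply: (cvgF (fun n => - n%:R)) => n; rewrite normrN ger0_norm.
Unshelve. all: by end_near. Qed.

Lemma integrable_partial_flux C i : 0 < C ->
  (@lebesgue4 R).-integrable setT (fun p => (partial_flux C i (point p))%:E).
Proof.
move=> C0; apply: (integrable_dominated4 C0 (K := 3132)).
  by apply: continuous_partial_flux; exact: ltW.
by move=> x; apply: partial_flux_bound; exact: ltW.
Qed.

Lemma integral_partial_flux C i : 0 < C ->
  (\int[@lebesgue4 R]_p (partial_flux C i (point p))%:E = 0)%E.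
Proof.
move=> C0; apply: (@integral4_zero _ C 3132 _ i C0).
- by apply: continuous_partial_flux; exact: ltW.
- by move=> x; apply: partial_flux_bound; exact: ltW.
- by move=> w wi; exact: partial_flux_slice.
Qed.

Lemma kw_instanton C : 0 <= C -> has_instanton_number (kwA C) 0.
Proof.
rewrite le_eqVlt => /predU1P[<-|C0].
  have z (p : R4 R) : chern_density (kwA (0 : R)) (point p) = 0.
    by rewrite chern_densityE// expr0n mul0r.
  split; first by under eq_fun do rewrite z; exact: integrable0.
  by rewrite /Rintegral integral0_eq ?mulr0// => p _; rewrite z.
have e p : (chern_density (kwA C) (point p))%:E =
    ((C ^+ 2)%:E * \sum_i (partial_flux C i (point p))%:E)%E.
  by rewrite chern_densityE ?ltW// EFinM sumEFin.
have iS : (@mu4 R).-integrable setT (fun p => \sum_i (partial_flux C i (point p))%:E)%E.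
  by apply: integrable_sum => // i _; exact: integrable_partial_flux.
have eF : (fun p => (chern_density (kwA C) (point p))%:E) = (fun p : R4 R =>
    (C ^+ 2)%:E * \sum_i (partial_flux C i (point p))%:E)%E.
  by apply/funext => p; exact: e.
have z : (\int[@mu4 R]_p ((C ^+ 2)%:E * \sum_i (partial_flux C i (point p))%:E) = 0)%E.
  rewrite (integralZl measurableT iS).
  rewrite (@integral_sum _ _ R (@mu4 R) setT measurableT _
    (fun i p => (partial_flux C i (point p))%:E)).
    by rewrite big1 ?mule0// => i _; exact: integral_partial_flux.
  by move=> i; exact: integrable_partial_flux.
split; first by rewrite eF; exact: (@integrableZl _ _ R (@mu4 R) setT measurableT (C ^+ 2) _ iS).
rewrite /Rintegral eF -[X in fine X]/(\int[@mu4 R]_p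
  ((C ^+ 2)%:E * \sum_i (partial_flux C i (point p))%:E))%E.
by rewrite z mulr0.
Qed.

End Instanton.

(** * Concentration of the curvature *)

Section Concentration.
Variable R : realType.
Implicit Types (C : R) (x : quat R).

Definition energy1 x : R := energy (1 * qnorm2 x).

Lemma energy1_gt0 x : 0 < energy1 x.
Proof. by rewrite energy_gt0// mul1r qnorm2_ge0. Qed.

Lemma continuous_energy1 : continuous energy1.
Proof. exact: continuous_energy. Qed.

Lemma measurable_energy1 : measurable_fun setT (fun p : R4 R => energy1 (point p)).
Proof. exact: measurable_point_continuous continuous_energy1. Qed.

Lemma integrable_bounded_energy1 (g : quat R -> R) (M : R) : continuous g ->
  (forall x, `|g x| <= M) ->
  (@mu4 R).-integrable setT (fun p => (g (point p) * energy1 (point p))%:E).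
Proof.
move=> cg gM; apply: (@integrable_dominated4 _ 1 (M * 216) (fun x => g x * energy1 x)) => //.
  by move=> x; exact: (cvgM (cg x) (@continuous_energy1 x)).
move=> x; rewrite normrM (gtr0_norm (energy1_gt0 x)) -mulrA ler_pM ?(ltW (energy1_gt0 x))//.
by apply: energy_bound; rewrite mul1r qnorm2_ge0.
Qed.

Lemma integrable_energy1 : (@mu4 R).-integrable setT (fun p => (energy1 (point p))%:E).
Proof.
rewrite (_ : (fun p => _) = fun p : R4 R => (1 * energy1 (point p))%:E).
  apply: (@integrable_bounded_energy1 (fun=> 1) 1) => [|x]; last by rewrite normr1.
  exact: cst_continuous.
by apply/funext => p; rewrite mul1r.
Qed.

Lemma mu4_setT : @mu4 R setT = +oo%E.
Proof.
have muT : @lebesgue_measure R setT = +oo%E by rewrite -set_itvNyy lebesgue_measure_itv.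
have prodT d1 d2 (T1 : measurableType d1) (T2 : measurableType d2)
    (m1 : {sigma_finite_measure set T1 -> \bar R})
    (m2 : {sigma_finite_measure set T2 -> \bar R}) :
    m1 setT = +oo%E -> m2 setT = +oo%E -> prod_sigma_finite m1 m2 setT = +oo%E.
  move=> h1 h2; rewrite -setXTT [LHS]product_measure1E//.
  by rewrite [X in (X * _)%E]h1 [X in (_ * X)%E]h2.
exact: (prodT _ _ _ _ _ _ (prodT _ _ _ _ _ _ (prodT _ _ _ _ _ _ muT muT) muT) muT).
Qed.

(** The integrand is positive everywhere and R^4 is not negligible. *)
Lemma integral_energy1_gt0 : 0 < fine (\int[@mu4 R]_p (energy1 (point p))%:E)%E.
Proof.
have i0 : (0 <= \int[@mu4 R]_p (energy1 (point p))%:E)%E.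
  by apply: integral_ge0 => p _; rewrite lee_fin ltW// energy1_gt0.
have fin := integrable_fin_num measurableT integrable_energy1.
rewrite lt0r fine_ge0// andbT; apply/eqP => f0.
have z : (\int[@mu4 R]_p `|(energy1 (point p))%:E| = 0)%E.
  rewrite -[RHS](_ : (fine (\int[@mu4 R]_p (energy1 (point p))%:E))%:E = 0%E); last by rewrite f0.
  rewrite fineK//; apply: eq_integral => p _.
  by rewrite gee0_abs// lee_fin ltW// energy1_gt0.
have mE : measurable_fun setT (fun p : R4 R => (energy1 (point p))%:E).
  by apply/measurable_EFinP; exact: measurable_energy1.
have [N [mN N0 hN]] := (ae_eq_integral_abs (@mu4 R) measurableT mE).1 z.
have NT : N = setT.
  apply/seteqP; split=> // p _; apply: hN => /= /(_ I) /eqP.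
  by rewrite eqe gt_eqF// energy1_gt0.
have h0 : @mu4 R setT = 0%E by rewrite -[RHS]N0 NT.
by rewrite mu4_setT in h0.
Qed.

(** The substitution x = y / sqrt C: the Jacobian C^-2 cancels the factor C^2 in
    front of the energy. *)
Lemma integral_rescale (g : quat R -> R) C : continuous g -> 0 < C ->
  (\int[@lebesgue4 R]_p
     (g (point p) * fnorm (curvature (kwA C)) (point p) ^+ 2)%:E =
   \int[@mu4 R]_p (g ((Num.sqrt C)^-1 *: point p) * energy1 (point p))%:E)%E.
Proof.
move=> cg C0; set c := (Num.sqrt C)^-1.
have c0 : 0 < c by rewrite invr_gt0 sqrtr_gt0.
have c2 : c * c * C = 1.
  have s0 : Num.sqrt C != 0 by rewrite gt_eqF// sqrtr_gt0.
  by rewrite /c -[X in _ * X = _](sqr_sqrtr (ltW C0)); field.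
pose G x := g x * fnorm (curvature (kwA C)) x ^+ 2.
have cG : continuous G.
  have ce := @continuous_energy R C (ltW C0).
  rewrite (_ : G = fun y => g y * (C ^+ 2 * energy (C * qnorm2 y))); last first.
    by apply/funext => y; rewrite /G fnorm_curvatureE// ltW.
  by move=> x; exact: (cvgM (cg x) (cvgM (cvg_cst _) (ce x))).
have mG : measurable_fun setT (fun p : R4 R => (G (point p))%:E).
  by apply/measurable_EFinP; exact: measurable_point_continuous.
rewrite -[LHS]/(\int[@lebesgue4 R]_p (G (point p))%:E)%E.
rewrite (dilation_integral (dilation_lebesgue4 c0) mG).
apply: eq_integral => p _; rewrite point_scale4 -EFinM /G fnorm_curvatureE ?ltW//.
congr EFin; rewrite /energy1.
have -> : qnorm2 (c *: point p) = c * c * qnorm2 (point p).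
  by rewrite !qnorm2E !qcoordE; ring.
have -> : C * (c * c * qnorm2 (point p)) = 1 * qnorm2 (point p) by rewrite -c2; ring.
rewrite -[RHS]mul1r -[X in _ = X * _](expr1n _ 2) -c2; ring.
Qed.

(** After rescaling, the density no longer depends on C and g is evaluated at
    y / sqrt C, which tends to 0. *)
Lemma kw_dirac : exists2 m : R, 0 < m &
  cvg_to_dirac (fun C x => fnorm (curvature (kwA C)) x ^+ 2) m 0.
Proof.
exists (fine (\int[@mu4 R]_p (energy1 (point p))%:E)%E); first exact: integral_energy1_gt0.
move=> g cg [M gM].
pose J C := (\int[@mu4 R]_p (g ((Num.sqrt C)^-1 *: point p) * energy1 (point p))%:E)%E.
have cgc (c : R) : continuous (fun x => g (c *: x)).
  move=> x; apply: (continuous_comp (f := fun y : quat R => c *: y)); last exact: cg.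
  exact: scaler_continuous.
have Jfin C : J C \is a fin_num.
  apply: integrable_fin_num => //.
  by apply: (@integrable_bounded_energy1 (fun x => g ((Num.sqrt C)^-1 *: x)) M).
suff cJ : fine (J C) @[C --> +oo] -->
    fine (\int[@mu4 R]_p (energy1 (point p))%:E)%E * g 0.
  apply: cvg_trans (cvg_EFin _ cJ); last exact: nearW.
  apply: near_eq_cvg; near=> C; rewrite integral_rescale//.
apply/cvg_pinftyP => u uy.
have h : J (u n) @[n --> \oo] --> (\int[@mu4 R]_p (g 0 * energy1 (point p))%:E)%E.
  pose f_ n (p : R4 R) := (g ((Num.sqrt (u n))^-1 *: point p) * energy1 (point p))%:E.
  have mf (h : quat R -> R) : continuous h ->
      measurable_fun setT (fun p : R4 R => (h (point p) * energy1 (point p))%:E).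
    move=> ch; apply/measurable_EFinP; apply: measurable_funM.
      exact: measurable_point_continuous.
    exact: measurable_energy1.
  have [] := @dominated_convergence _ _ _ (@mu4 R) setT measurableT f_
    (fun p => (g 0 * energy1 (point p))%:E) (fun p => (M * energy1 (point p))%:E).
  - by move=> n; apply: (mf (fun x => g ((Num.sqrt (u n))^-1 *: x))).
  - by apply: (mf (fun=> g 0)); exact: cst_continuous.
  - apply: aeW => p _; apply: cvg_EFin; first exact: nearW.
    rewrite /f_; apply: cvgM; last exact: cvg_cst.
    have s0 : (Num.sqrt (u n))^-1 @[n --> \oo] --> (0 : R).
      apply/cvgrPdist_le => e e0; near=> n.
      have un : (e ^+ 2)^-1 <= u n by near: n; move/cvgryPge : uy; exact.
      have e2 : 0 < e ^+ 2 by rewrite exprn_gt0.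
      have un0 : 0 < u n by rewrite (lt_le_trans _ un)// invr_gt0.
      rewrite sub0r normrN ger0_norm ?invr_ge0 ?sqrtr_ge0//.
      rewrite invf_ple ?posrE ?sqrtr_gt0//.
      rewrite -(@ler_pXn2r _ 2) ?nnegrE ?invr_ge0 ?sqrtr_ge0 ?(ltW e0)//.
      by rewrite (sqr_sqrtr (ltW un0)) exprVn.
    have h1 : (Num.sqrt (u n))^-1 *: point p @[n --> \oo] --> (0 : quat R).
      rewrite -[X in _ --> X](scale0r (point p)); exact: cvgZr_tmp.
    exact: (cvg_comp _ _ h1 (cg 0)).
  - by apply: (@integrable_bounded_energy1 (fun=> M) `|M|) => //; exact: cst_continuous.
  - apply: aeW => p n _; rewrite /f_ abse_EFin lee_fin normrM (gtr0_norm (energy1_gt0 _)).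
    by rewrite ler_pM2r// energy1_gt0.
  by move=> _ _.
apply: fine_cvg; rewrite EFinM fineK; last exact: integrable_fin_num integrable_energy1.
rewrite muleC -(integralZl measurableT integrable_energy1).
exact: h.
Unshelve. all: by end_near. Qed.

Lemma fnorm_curvature_ge0 C x : 0 <= fnorm (curvature (kwA C)) x.
Proof. exact: sqrtr_ge0. Qed.

Lemma curvature_blowup : (fun C : R => fnorm (curvature (kwA C)) 0) @ +oo --> +oo.
Proof.
apply/cvgryPge => A; near=> C.
have C0 : 0 < C by near: C; exact: nbhs_pinfty_gt.
apply: (@le_trans _ _ C); first by near: C; apply: nbhs_pinfty_ge; exact: num_real.
rewrite -(@ler_pXn2r _ 2) ?nnegrE ?fnorm_curvature_ge0 ?(ltW C0)// fnorm_curvatureE ?(ltW C0)//.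
rewrite qnorm2E !qcoord0 expr0n/= !addr0 mulr0 /energy /quad.
rewrite ler_peMr ?sqr_ge0// expr0n/= mulr0 !addr0 !add0r subr0 !expr1n divr1.
lra.
Unshelve. all: by end_near. Qed.

Lemma curvature_vanish x : x != 0 ->
  (fun C : R => fnorm (curvature (kwA C)) x) @ +oo --> (0 : R).
Proof.
move=> x0; have t0 : 0 < qnorm2 x.
  rewrite lt0r qnorm2_ge0 andbT; apply: contra x0 => /eqP h.
  apply/eqP/quatP; move: h; rewrite qnorm2E !qcoord0.
  have := sqr_ge0 (q1 x); have := sqr_ge0 (qI x).
  have := sqr_ge0 (qJ x); have := sqr_ge0 (qK x) => k0 j0 i0 l0 h.
  by split; apply/eqP; rewrite -sqrf_eq0; apply/eqP; lra.
set t := qnorm2 x in t0.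
apply/cvgrPdist_le => e e0; near=> C.
have C0 : 0 < C by near: C; exact: nbhs_pinfty_gt.
(* The bound 216 on the energy is below 15 ^ 2. *)
have Ce : 15 / (e * t ^+ 2) <= C by near: C; apply: nbhs_pinfty_ge; exact: num_real.
have s0 : 0 < C * t by exact: mulr_gt0.
rewrite sub0r normrN ger0_norm ?fnorm_curvature_ge0//.
rewrite -(@ler_pXn2r _ 2) ?nnegrE ?fnorm_curvature_ge0 ?(ltW e0)// fnorm_curvatureE ?(ltW C0)//.
rewrite -/t; apply: (@le_trans _ _ (C ^+ 2 * (216 / (C * t) ^+ 4))).
  rewrite ler_pM2l ?exprn_gt0//; apply: le_trans (energy_bound (ltW s0)) _.
  have s1 : 0 < 1 + C * t by rewrite ltr_pwDl// ltW.
  rewrite ler_pM2l// lef_pV2 ?posrE ?exprn_gt0//.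
  by rewrite lerXn2r ?nnegrE ?(ltW s0) ?(ltW s1)// lerDr.
have -> : C ^+ 2 * (216 / (C * t) ^+ 4) = 216 / (C * t ^+ 2) ^+ 2.
  by field; rewrite !gt_eqF.
rewrite ler_pdivrMr ?exprn_gt0 ?mulr_gt0 ?exprn_gt0// -exprMn.
have h : 15 <= e * (C * t ^+ 2).
  have -> : e * (C * t ^+ 2) = C * (e * t ^+ 2) by ring.
  by rewrite -ler_pdivrMr// mulr_gt0// exprn_gt0.
nra.
Unshelve. all: by end_near. Qed.

End Concentration.

(** * The one-parameter family of solutions *)

Theorem theorem1p1 (R : realType) :
  (forall C : R,
    [/\ KW_solution (kw_domain C) (kwA C) (kwPhi C),
        (0 < C -> smooth_form (~` pole_sphere C) (kwA C) /\
                  smooth_form (~` pole_sphere C) (kwPhi C)) /\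
        (C != 0 -> decays (kwA C) /\ decays (kwPhi C)),
        0 <= C -> has_instanton_number (kwA C) 0 &
        0 < C -> forall x0, pole_sphere C x0 ->
          ~ gauge_removable_at (pole_sphere C) (kwPhi C) x0]) /\
  [/\ (fun C : R => fnorm (curvature (kwA C)) 0) @ +oo --> +oo,
      forall x : quat R, x != 0 ->
        (fun C : R => fnorm (curvature (kwA C)) x) @ +oo --> (0 : R) &
      exists2 m : R, 0 < m &
        cvg_to_dirac (fun (C : R) x => fnorm (curvature (kwA C)) x ^+ 2) m 0].
Proof.
split=> [C|].
  split.
  - exact: kw_solution.
  - by split=> C0; [exact: kw_smooth|split; [exact: kwA_decays|exact: kwPhi_decays]].
  - exact: kw_instanton.
  - by move=> C0 x0; exact: kw_pole.
split; [exact: curvature_blowup|exact: curvature_vanish|exact: kw_dirac].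
Qed.
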